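(* Let $G$ be a connected graph in which every vertex has degree 1 or 3, every vertex of degree 1 is adjacent to a vertex of degree 3, and every vertex of degree 3 lies in at least one 3-cycle. Then there exists a color-blind distinguishing edge-coloring $c:E(G)\to\{1,2,3\}$ if and only if $G$ is not an odd cycle of diamonds. Moreover, when such a coloring exists, for every vertex $v$ of degree 3 that is adjacent to a vertex of degree 1, there are two color-blind distinguishing edge-colorings $c_1,c_2:E(G)\to\{1,2,3\}$ with $c_1^*(v)\neq c_2^*(v)$.
   Context: For an edge-coloring $c:E(G)\to\{1,2,3\}$ (not necessarily proper), $\bar c(v)=(a_1,a_2,a_3)$ where $a_i$ is the number of edges at $v$ of color $i$, and $c^*(v)$ is $\bar c(v)$ sorted in nonincreasing order; $c$ is color-blind distinguishing if $c^*(u)\ne c^*(v)$ for every edge $uv$. A diamond is a subgraph consisting of two 3-cycles sharing an edge. A cycle of diamonds is a 3-regular graph in which every vertex lies in a diamond; it is an odd cycle of diamonds if it has $4t$ vertices for an odd integer $t$ ($K_4$ counts as one). *)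

(* Defs.v *)
From mathcomp Require Export all_boot.

Set Implicit Arguments.
Unset Strict Implicit.
Unset Printing Implicit Defensive.

(* A finite simple graph is a symmetric irreflexive relation [e] on a finType
   of vertices. *)
Section Graph.

Variables (T : finType) (e : rel T).

Definition simple_graph : Prop := symmetric e /\ irreflexive e.

Definition connected_graph : Prop :=
  0 < #|T| /\ forall x y : T, connect e x y.

Definition degree (x : T) : nat := #|[set y | e x y]|.

Definition edge_set : {set {set T}} :=
  [set A | [exists x, exists y, e x y && (A == [set x; y])]].

Definition edge := {A : {set T} | A \in edge_set}.

Definition in_three_cycle (v : T) : Prop :=
  exists a b c : T, ucycle e [:: a; b; c] /\ v \in [:: a; b; c].

(* The 3-cycles abx and aby share the edge ab; the subgraph need not be
   induced, so x and y may be adjacent (as in K_4). *)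
Definition diamond (a b x y : T) : Prop :=
  [/\ ucycle e [:: a; b; x], ucycle e [:: a; b; y] & x != y].

Definition in_diamond (v : T) : Prop :=
  exists a b x y : T, diamond a b x y /\ v \in [:: a; b; x; y].

Definition cycle_of_diamonds : Prop :=
  (forall v : T, degree v = 3) /\ (forall v : T, in_diamond v).

Definition odd_cycle_of_diamonds : Prop :=
  cycle_of_diamonds /\ exists t : nat, odd t /\ #|T| = 4 * t.

(* The colors 1, 2, 3 are the elements of 'I_3. *)
Definition coloring := edge -> 'I_3.

Definition color_count (c : coloring) (v : T) (i : 'I_3) : nat :=
  #|[set A : edge | (v \in val A) && (c A == i)]|.

Definition cbar (c : coloring) (v : T) : 3.-tuple nat :=
  [tuple color_count c v i | i < 3].

Definition cstar (c : coloring) (v : T) : seq nat := sort geq (cbar c v).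

Definition color_blind_distinguishing (c : coloring) : Prop :=
  forall u v : T, e u v -> cstar c u <> cstar c v.

End Graph.

(* Main.v *)
Require Import Defs.
From mathcomp Require Import all_boot.

Set Implicit Arguments.
Unset Strict Implicit.
Unset Printing Implicit Defensive.

(** At a vertex of degree 3, [cstar] amounts to the number 1, 2 or 3 of colours
    at the vertex, its type, so a color-blind distinguishing coloring is one whose types
    are distinct at adjacent vertices of degree 3.  The edges in triangles split
    the graph into blobs (leaves, triangles, diamonds, or K4), and the other
    edges, the outer ones, match the exits of the blobs.  A triangle has one
    vertex of each type; the two ends of a diamond have the same type, which is
    not 1.  On a cycle of diamonds types 2 and 3 hence alternate, so the number
    of diamonds is even.

    Conversely, types are found by a list colouring in which every exit has as
    many available types as constraints.  Greedy colouring succeeds as soon as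
    there is slack, i.e., a leaf.  Without slack a triangle on a cycle of blobs
    allows the argument used for Brooks' theorem.  Pinning the type seen by one
    leaf is also covered, which gives the two different types next to a leaf.

    Types can always be realized by colours: the outer edges only have to
    satisfy that at each triangle the edge at the type-3 vertex differs from the
    other two, and that the edges at a type-3 diamond agree.  As every triangle
    has a single type-3 vertex, these constraints form a functional graph, which
    is 3-colourable. *)

(** * Reachability, involutions and functional graphs *)

Lemma connect_invariant (T : finType) (r : rel T) (P : T -> Prop) x y :
  (forall u w, P u -> r u w -> P w) -> P x -> connect r x y -> P y.
Proof.
move=> step Px /connectP [p]; elim: p x Px => [|z p IHp] x Px /=.
  by move=> _ ->.
by case/andP=> rxz pz yE; apply: IHp pz yE; apply: step rxz.
Qed.

Lemma even_card_involution (T : finType) (A : {set T}) (f : T -> T) :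
  {in A, forall x, [/\ f x \in A, f (f x) = x & f x != x]} -> ~~ odd #|A|.
Proof.
move: {2}#|A| (leqnn #|A|) => n; elim: n A => [|n IHn] A.
  by rewrite leqn0 cards_eq0 => /eqP-> _; rewrite cards0.
move=> leA fA; have [->|[x Ax]] := set_0Vmem A; first by rewrite cards0.
have [Afx ffx fx] := fA x Ax.
have Afx' : f x \in A :\ x by rewrite !inE fx.
have E : #|A| = (#|A :\ x :\ f x|).+2 by rewrite (cardsD1 x) Ax (cardsD1 (f x)) Afx'.
rewrite E /= negbK; apply: IHn => [|y]; first by rewrite E in leA; apply: ltnW.
rewrite !inE => /and3P[yfx yx Ay]; have [Afy ffy fy] := fA y Ay.
split=> //; rewrite Afy andbT; apply/andP; split.
  by apply: contra yx => /eqP fyfx; rewrite -ffy fyfx ffx.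
by apply: contra yfx => /eqP <-; rewrite ffy.
Qed.

Definition avoid (a b : 'I_3) : 'I_3 := odflt ord0 [pick c | (c != a) && (c != b)].

Lemma avoidP a b : avoid a b != a /\ avoid a b != b.
Proof.
rewrite /avoid; case: pickP => [c /andP[]//|none].
have : ~: [set a; b] == set0.
  by apply/eqP/setP=> c; rewrite !inE negb_or none.
by rewrite -cards_eq0 cardsCs setCK card_ord cards2; case: (a != b).
Qed.

Lemma avoidC a b : avoid a b = avoid b a.
Proof. by congr odflt; apply: eq_pick => c; rewrite andbC. Qed.

(* Every nonempty set of vertices has one with at most one preimage in it, hence
   with at most two neighbours, so that greedy colouring works. *)
Lemma functional_graph_3_coloring (V : finType) (f : V -> V) :
  exists rho : V -> 'I_3, forall v, f v != v -> rho v != rho (f v).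
Proof.
suff H (S : {set V}) : exists rho : V -> 'I_3,
    {in S, forall v, f v \in S -> f v != v -> rho v != rho (f v)}.
  by have [rho rhoP] := H setT; exists rho => v; apply: rhoP; rewrite inE.
move: {2}#|S| (leqnn #|S|) => n; elim: n S => [|n IHn] S.
  by rewrite leqn0 cards_eq0 => /eqP->; exists (fun=> ord0) => v; rewrite inE.
move=> leS; have [->|[v0 v0S]] := set_0Vmem S; first by exists (fun=> ord0) => v; rewrite inE.
have [v [u0 [vS vU]]] : exists v u0, v \in S /\ {in S, forall u, f u = v -> u = u0}.
  (* Either some vertex of [S] has no preimage in [S], or [f] maps [S] onto a set containing [S] and
     is injective on [S] by counting. *)
  have [sub|/subsetPn[v vS vf]] := boolP (S \subset f @: S); last first.
    by exists v, v; split=> // u uS fu; rewrite -fu imset_f in vf.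
  have /imset_injP inj : #|f @: S| == #|S|.
    by rewrite eqn_leq leq_imset_card subset_leq_card.
  have /imsetP[u0 u0S v0E] := subsetP sub _ v0S.
  by exists v0, u0; split=> // u uS fu; apply: inj => //; rewrite fu.
have [|rho rhoP] := IHn (S :\ v); first by rewrite (cardsD1 v) vS in leS.
pose rho' x := if x == v then avoid (rho u0) (rho (f v)) else rho x.
exists rho' => u uS fuS fu; rewrite /rho'.
have [n1 n2] := avoidP (rho u0) (rho (f v)).
have [uv|uv] := eqVneq u v; first by subst u; rewrite (negPf fu).
have [fuv|fuv] := eqVneq (f u) v; first by rewrite (vU u) // eq_sym.
by apply: rhoP; rewrite ?inE ?uv ?fuv.
Qed.

(** * Types of the exits of the blobs *)

(* The elements of [V] are the vertices incident to an outer edge, [o] is the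
   other end of that edge and [bl] the blob of the vertex: a leaf, a diamond or
   a triangle according to the number 1, 2 or 3 of exits of the blob. *)
Section Exits.

Variables (V : finType) (B : eqType) (o : V -> V) (bl : V -> B).

Definition cls (v : V) : {set V} := [set u | bl u == bl v].

Hypothesis oK : involutive o.
Hypothesis bl_o : forall v, bl (o v) != bl v.
Hypothesis cls_le3 : forall v, #|cls v| <= 3.
Hypothesis exits_connected : forall S : {set V}, S != set0 ->
  (forall v, v \in S -> o v \in S) ->
  (forall u v, v \in S -> bl u = bl v -> u \in S) -> S = setT.

Implicit Types (u v w : V) (X A S D : {set V}) (tau : V -> option bool).
Implicit Types (L : V -> {set option bool}).

(** Neighbourhoods of the constraint graph. The degree of [v] in it is the size of its class
    ([card_cnbr]), so lists of that size are exactly as long as the number of constraints. *)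
Definition cnbr v : {set V} := o v |: cls v :\ v.

(* The equality required between the two ends of a diamond is encoded, in terms
   of the two types that they may take, as each end forbidding one type to the
   other.  Thus every constraint forbids exactly one type. *)
Definition forbid u v (c : option bool) : option bool :=
  if (bl u == bl v) && (#|cls v| == 2) then omap negb c else c.

Definition proper_on L tau X :=
  {in X, forall v, tau v \in L v} /\
  {in X &, forall u v, u \in cnbr v -> tau v != forbid u v (tau u)}.

Lemma cls_refl v : v \in cls v.
Proof. by rewrite inE. Qed.

Lemma cls_eq u v : bl u = bl v -> cls u = cls v.
Proof. by move=> E; apply/setP=> w; rewrite !inE E. Qed.

Lemma in_cnbr u v : (u \in cnbr v) = (u == o v) || (u != v) && (bl u == bl v).
Proof. by rewrite !inE. Qed.

Lemma cnbr_sym u v : (u \in cnbr v) = (v \in cnbr u).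
Proof.
rewrite !in_cnbr [v == u]eq_sym [bl v == _]eq_sym; congr (_ || _).
by apply/eqP/eqP=> ->; rewrite oK.
Qed.

Lemma card_cnbr v : #|cnbr v| = #|cls v|.
Proof.
rewrite cardsU1 (cardsD1 v (cls v)) cls_refl !inE.
by rewrite (negPf (bl_o v)) andbF.
Qed.

(** Negation of types is an involution, so a constraint violated at one end is violated at the
    other, whichever end is coloured last. *)
Lemma forbid_sym u v c d : (c == forbid u v d) = (d == forbid v u c).
Proof.
rewrite /forbid [bl v == _]eq_sym; have [E|_] /= := eqVneq (bl u) (bl v).
  by rewrite (cls_eq E); case: ifP => _; case: c d => [[]|] [[]|].
exact: eq_sym.
Qed.

Lemma color_one L tau X v c :
  proper_on L tau X -> v \notin X -> c \in L v ->
  {in X, forall u, u \in cnbr v -> c != forbid u v (tau u)} ->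
  exists2 tau', {in X, tau' =1 tau} /\ tau' v = c & proper_on L tau' (v |: X).
Proof.
move=> [tauL tauP] vX cL cP.
pose tau' u := if u == v then c else tau u.
have EX : {in X, tau' =1 tau}.
  by move=> u uX; rewrite /tau'; case: eqP uX vX => // -> ->.
have Ev : tau' v = c by rewrite /tau' eqxx.
exists tau' => //; split=> [u|u w].
  by case/setU1P=> [->|uX]; rewrite ?Ev // EX // tauL.
case/setU1P=> [->|uX] /setU1P[->|wX]; rewrite ?Ev ?EX //.
- by rewrite in_cnbr eqxx /= orbF => /eqP vo; move: (bl_o v); rewrite -vo eqxx.
- by rewrite cnbr_sym forbid_sym => /cP; apply.
- by move/cP; apply.
exact: tauP.
Qed.

Lemma color_available L tau v A :
  #|A| < #|L v| -> exists2 c, c \in L v & {in A, forall u, c != forbid u v (tau u)}.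
Proof.
move=> ltAL; pose F := [set forbid u v (tau u) | u in A].
have /subsetPn[c cL cF] : ~~ (L v \subset F).
  apply: contraL ltAL => /subset_leq_card le; rewrite -leqNgt.
  exact: leq_trans le (leq_imset_card _ _).
exists c => // u uA; apply: contra cF => /eqP->; exact: imset_f.
Qed.

(* Greedy colouring: the last vertex of [A] to be coloured is one with a
   neighbour that stays uncoloured. *)
Lemma extend_coloring L tau X A :
  (forall v, #|cls v| <= #|L v|) -> proper_on L tau X -> [disjoint A & X] ->
  (forall S, S \subset A -> S != set0 ->
     exists2 v, v \in S & exists2 u, u \in cnbr v & u \notin S :|: X) ->
  exists2 tau', {in X, tau' =1 tau} & proper_on L tau' (A :|: X).
Proof.
move=> HL tauP; move: {2}#|A| (leqnn #|A|) => n; elim: n A => [|n IHn] A.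
  by rewrite leqn0 cards_eq0 => /eqP-> _ _; exists tau; rewrite ?set0U.
move=> leA dAX esc; have [->|A0] := eqVneq A set0; first by exists tau; rewrite ?set0U.
have [v vA [u uv uAX]] := esc A (subxx _) A0.
have [||| t tX tP] := IHn (A :\ v).
- by rewrite (cardsD1 v) vA in leA.
- by apply: disjointWl dAX; apply: subD1set.
- by move=> S sS; apply: esc; apply: subset_trans sS (subD1set _ _).
have vX : v \notin X by rewrite (disjointFr dAX vA).
pose M := [set w in cnbr v | w != u].
have ltM : #|M| < #|L v|.
  apply: leq_trans (HL v); rewrite -card_cnbr (cardsD1 u (cnbr v)) uv add1n ltnS.
  by apply: subset_leq_card; apply/subsetP=> w; rewrite !inE andbC.
have [c cL cM] := color_available t ltM.
have vAX : v \notin A :\ v :|: X by rewrite !inE eqxx.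
have [|t' [t'X _] t'P] := color_one tP vAX cL.
  move=> w wAX wv; apply: cM; rewrite inE wv /=.
  apply: contra uAX => /eqP<-; move: wAX; rewrite !inE.
  by case/orP=> [/andP[_ ->]|->]; rewrite ?orbT.
exists t' => [w wX|]; first by rewrite t'X ?tX // inE wX orbT.
by rewrite setUA setD1K in t'P.
Qed.

Lemma proper_on0 L tau : proper_on L tau set0.
Proof. by split=> [v|u v]; rewrite inE. Qed.

Lemma leaves_or_closed S X :
  (exists2 v, v \in S & exists2 u, u \in cnbr v & u \notin X) \/
  (forall u v, v \in S -> u \in cnbr v -> u \in X).
Proof.
have [/exists_inP[v vS /exists_inP[u uv uX]]|/exists_inPn H] :=
  boolP [exists v in S, exists u in cnbr v, u \notin X].
  by left; exists v => //; exists u.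
by right=> u v /H/exists_inPn Hv /Hv; rewrite negbK.
Qed.

(** Connectedness of the constraint graph, in the form that greedy colouring consumes. *)
Lemma escape S : S != set0 -> S != setT ->
  exists2 v, v \in S & exists2 u, u \in cnbr v & u \notin S.
Proof.
move=> S0 ST; have [//|H] := leaves_or_closed S S.
case/eqP: ST; apply: exits_connected => // [v vS|u v vS E].
  by apply: H vS _; rewrite in_cnbr eqxx.
have [->//|uv] := eqVneq u v.
by apply: H vS _; rewrite in_cnbr uv E eqxx orbT.
Qed.

(** Greedy colouring towards [w]: any nonempty set without [w] has a constraint leaving it. *)
Lemma color_all_but L w : (forall v, #|cls v| <= #|L v|) ->
  exists tau, proper_on L tau [set~ w].
Proof.
move=> HL; have [||t _] := @extend_coloring L (fun=> None) set0 [set~ w] HL (proper_on0 _ _).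
- by rewrite disjoint_sym -setI_eq0 set0I.
- move=> S sS S0; rewrite setU0; apply: escape => //.
  by apply: contraTneq sS => ->; apply/subsetPn; exists w; rewrite !inE ?eqxx.
by rewrite setU0; exists t.
Qed.

Lemma color_slack L w : (forall v, #|cls v| <= #|L v|) -> #|cls w| < #|L w| ->
  exists tau, proper_on L tau setT.
Proof.
move=> HL ltw; have [t tP] := color_all_but w HL.
rewrite -card_cnbr in ltw; have [c cL cP] := color_available t ltw.
have [||t' _] := color_one tP _ cL; first by rewrite !inE eqxx.
  by move=> u _; apply: cP.
by rewrite setUCr; exists t'.
Qed.

Definition avoiding (D : {set V}) : rel V :=
  fun u w => [&& w \in cnbr u, u \notin D & w \notin D].

Lemma avoiding_sym D : symmetric (avoiding D).
Proof. by move=> u w; rewrite /avoiding cnbr_sym; congr (_ && _); rewrite andbC. Qed.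

Lemma connect_avoiding_sym D u w : connect (avoiding D) u w = connect (avoiding D) w u.
Proof. exact/sym_connect_sym/avoiding_sym. Qed.

Lemma connect_avoiding_notin D u w : u \notin D -> connect (avoiding D) u w -> w \notin D.
Proof. by apply: (connect_invariant (P := fun x => x \notin D)) => x y _ /and3P[]. Qed.

(* Brooks' trick: [o c] and [a] get the same colour, which leaves a colour for
   [c] at the end. *)
Lemma color_triangle L a b c : (forall v, #|cls v| <= #|L v|) ->
  cls a = [set a; b; c] -> uniq [:: a; b; c] -> L a = setT -> L c = setT ->
  connect (avoiding (o c |: cls a)) (o a) (o b) ->
  exists tau, proper_on L tau setT.
Proof.
move=> HL clsa; rewrite /= !inE !negb_or andbT => /andP[/andP[ab ac] bc] La Lc cn.
set D := o c |: cls a in cn.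
have in_cls x : (x \in cls a) = [|| x == a, x == b | x == c].
  by rewrite clsa !inE orbA.
have blb : bl b = bl a by apply/eqP; have := in_cls b; rewrite eqxx orbT inE.
have blc : bl c = bl a by apply/eqP; have := in_cls c; rewrite eqxx !orbT inE.
have o_cls x : bl x = bl a -> o x \notin cls a by move=> E; rewrite inE -E bl_o.
have oaD : o a \notin D.
  by rewrite in_setU1 negb_or o_cls // andbT (inj_eq (can_inj oK)).
(* Order of colouring: first [B1], which contains [o c]; then [a], none of whose neighbours is
   coloured yet, with the type of [o c]; then [R] together with [b]; finally [c]. *)
pose R := [set u | connect (avoiding D) (o a) u].
have RD u : u \in R -> u \notin D by rewrite inE; apply: connect_avoiding_notin.
have aR : a \notin R by apply/negP=> /RD; rewrite in_setU1 in_cls eqxx orbT.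
have bR : b \notin R by apply/negP=> /RD; rewrite in_setU1 in_cls eqxx !orbT.
have cR : c \notin R by apply/negP=> /RD; rewrite in_setU1 in_cls eqxx !orbT.
pose B1 := ~: (R :|: cls a).
have inB1 u : u \in B1 = ~~ [|| u \in R, u == a, u == b | u == c].
  by rewrite in_setC in_setU in_cls.
have ocB1 : o c \in B1.
  rewrite in_setC in_setU negb_or o_cls // andbT.
  by apply/negP=> /RD; rewrite in_setU1 eqxx.
have oaR : o a \in R by rewrite inE connect0.
have [||t1 _] := @extend_coloring L (fun=> None) set0 B1 HL (proper_on0 _ _).
- by rewrite disjoint_sym -setI_eq0 set0I.
- move=> S sS S0; rewrite setU0; apply: escape => //.
  by apply: contraTneq sS => ->; apply/subsetPn; exists a; rewrite ?in_setT // inB1 eqxx !orbT.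
rewrite setU0 => t1P.
have aB1 : a \notin B1 by rewrite inB1 eqxx !orbT.
have [||t2 [t2B1 t2a] t2P] := @color_one L t1 B1 a (t1 (o c)) t1P aB1.
- by rewrite La inE.
- move=> u uB1; rewrite in_cnbr => /orP[/eqP uE|/andP[ua blu]].
    by move: uB1; rewrite uE inB1 oaR.
  have : u \in cls a by rewrite inE.
  by rewrite in_cls; move: uB1; rewrite inB1 !negb_or => /and4P[_ /negPf-> /negPf-> /negPf->].
pose A2 := b |: R.
have cnb : c \in cnbr b by rewrite in_cnbr [c == b]eq_sym bc blb blc eqxx orbT.
have bnob : b \in cnbr (o b) by rewrite in_cnbr oK eqxx.
have bX : b \notin a |: B1 by rewrite in_setU1 inB1 eqxx !orbT orbF eq_sym.
have cX : c \notin a |: B1 by rewrite in_setU1 inB1 eqxx !orbT orbF eq_sym.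
have [||t3 t3X t3P] := @extend_coloring L t2 (a |: B1) A2 HL t2P.
- rewrite disjoint_subset; apply/subsetP=> u; rewrite !inE => /orP[/eqP->|uR].
    by rewrite eq_sym (negPf ab) blb eqxx orbT.
  by rewrite negb_or uR andbT; apply: contraNneq aR => <-; rewrite inE.
(* The uncoloured neighbour is [c] for [b], and [b] for [o b]. A set containing neither [b] nor
   [o b] that no constraint leaves towards an uncoloured vertex would spread over the component [R]
   and reach [o b] after all. *)
- move=> S sS S0; have [bS|bS] := boolP (b \in S).
    exists b => //; exists c => //; rewrite in_setU negb_or cX andbT.
    apply/negP=> /(subsetP sS); rewrite in_setU1 eq_sym (negPf bc) /=; exact/negP.
  have sR : S \subset R.
    apply/subsetP=> u uS; move/subsetP: sS => /(_ u uS); rewrite in_setU1.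
    by case/orP=> // /eqP ub; rewrite ub (negPf bS) in uS.
  have [obS|obS] := boolP (o b \in S).
    by exists (o b) => //; exists b => //; rewrite in_setU negb_or bS bX.
  have [//|H] := leaves_or_closed S (S :|: (a |: B1)).
  case/negP: obS.
  have /set0Pn[s sinS] := S0.
  have : connect (avoiding D) s (o b).
    rewrite connect_avoiding_sym; apply: connect_trans (_ : connect _ (o b) (o a)) _.
      by rewrite connect_avoiding_sym.
    by move/subsetP: sR => /(_ s sinS); rewrite inE.
  apply: (connect_invariant (P := fun x => x \in S)) sinS => u w uS /and3P[wu uD wD].
  have /setUP[//|] := H w u uS wu.
  have wR : w \in R.
    move/subsetP: sR => /(_ u uS); rewrite !inE => cu.
    by apply: connect_trans cu (connect1 _); rewrite /avoiding wu uD.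
  rewrite in_setU1 inB1 wR orbF => /eqP wa.
  by rewrite wa in_setU1 in_cls eqxx orbT in wD.
have ocX : o c \in a |: B1 by rewrite in_setU1 ocB1 orbT.
have t3a : t3 a = t1 (o c) by rewrite t3X ?setU11.
have t3oc : t3 (o c) = t1 (o c) by rewrite t3X // t2B1.
have c3 : #|cls c| == 3.
  by rewrite (cls_eq blc) clsa setUC !cardsU1 cards1 !inE ![c == _]eq_sym (negPf ac) (negPf bc) ab.
have cA : c \notin A2 :|: (a |: B1).
  by rewrite in_setU negb_or cX andbT in_setU1 negb_or cR eq_sym bc.
(* The three constraints on [c] exclude only two types, as [a] and [o c] share theirs. *)
have [d /setD1P[db]] : exists d : option bool, d \in [set~ t1 (o c)] :\ t3 b.
  apply/set0Pn; rewrite -card_gt0.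
  have := cardsD1 (t3 b) [set~ t1 (o c)].
  by rewrite cardsC1 card_option card_bool; case: #|_ :\ _| => //; case: (_ \in _).
rewrite in_setC1 => doc.
have [||t4 _] := @color_one L t3 _ c d t3P cA; first by rewrite Lc inE.
  move=> u _; rewrite in_cnbr => /orP[/eqP->|/andP[uc blu]].
    by rewrite /forbid (negPf (bl_o c)) t3oc.
  rewrite /forbid (eqP c3) andbF.
  have : u \in cls a by rewrite inE -blc.
  by rewrite in_cls (negPf uc) orbF => /orP[] /eqP-> //; rewrite t3a.
suff -> : c |: (A2 :|: (a |: B1)) = setT by exists t4.
apply/setP=> u; rewrite in_setU1 !in_setU !in_set1 inB1 in_setT.
by case: (u == a); case: (u == b); case: (u == c); case: (u \in R).
Qed.

(** * Triangles on a cycle of blobs *)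

Lemma cls_gt0 v : 0 < #|cls v|.
Proof. by apply/card_gt0P; exists v; apply: cls_refl. Qed.

Lemma cls3_third a b : #|cls a| = 3 -> bl b = bl a -> a != b ->
  exists c, cls a = [set a; b; c] /\ uniq [:: a; b; c].
Proof.
move=> c3 bla ab; have bcls : b \in cls a :\ a by rewrite !inE eq_sym ab bla eqxx.
have /eqP/cards1P[c cE] : #|cls a :\ a :\ b| = 1.
  by move: c3; rewrite (cardsD1 a) cls_refl (cardsD1 b) bcls => -[].
exists c; split.
  by rewrite -(setD1K (cls_refl a)) -(setD1K bcls) cE setUA.
have : c \in cls a :\ a :\ b by rewrite cE set11.
by rewrite 2!in_setD1 /= !inE negb_or ab andbT ![_ == c]eq_sym => /and3P[-> -> _].
Qed.

(** What can be reached through the exit [a] without returning to its blob. A triangle lies on a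
    cycle of blobs when [comp a] contains [o b] for another of its exits [b]. *)
Definition comp a : {set V} := [set u | connect (avoiding (cls a)) (o a) u].

Lemma o_notin_cls a b : bl b = bl a -> o b \notin cls a.
Proof. by move=> E; rewrite inE -E bl_o. Qed.

Lemma comp_notin_cls a u : u \in comp a -> u \notin cls a.
Proof. by rewrite inE; apply: connect_avoiding_notin; apply: o_notin_cls. Qed.

Lemma comp_step a u w : u \in comp a -> w \in cnbr u -> w \notin cls a -> w \in comp a.
Proof.
move=> uc wu wa; have ua := comp_notin_cls uc; move: uc; rewrite !inE => uc.
by apply: connect_trans uc (connect1 _); rewrite /avoiding wu ua.
Qed.

Lemma comp_o a : o a \in comp a.
Proof. by rewrite inE connect0. Qed.

Lemma comp_cls a u w : u \in comp a -> bl w = bl u -> w \in comp a.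
Proof.
move=> uc E; have [->//|wu] := eqVneq w u.
apply: (comp_step uc); first by rewrite in_cnbr wu E eqxx orbT.
by have := comp_notin_cls uc; rewrite !inE E.
Qed.

(** If [o a] reaches [o b] without [o c], then [color_triangle] applies. Otherwise every path to
    [o b] meets [o c] first, so [o c] is reached without [o b], and [b] and [c] exchange roles. *)
Lemma color_on_cycle L a b : (forall v, #|cls v| <= #|L v|) ->
  (forall v, #|cls v| = 3 -> L v = setT) ->
  #|cls a| = 3 -> bl b = bl a -> a != b -> o b \in comp a ->
  exists tau, proper_on L tau setT.
Proof.
move=> HL L3 c3 blb ab; rewrite inE => cab.
have [c [clsa uabc]] := cls3_third c3 blb ab.
have blc : bl c = bl a.
  have : c \in cls a by rewrite clsa !inE eqxx !orbT.
  by rewrite inE => /eqP.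
have [cn|ncn] := boolP (connect (avoiding (o c |: cls a)) (o a) (o b)).
  by apply: color_triangle clsa uabc _ _ cn => //; apply: L3; rewrite // (cls_eq blc).
have o_inj := can_inj oK.
have oD x : bl x = bl a -> a != x -> o a \notin o x |: cls a.
  by move=> blx ax; rewrite in_setU1 (inj_eq o_inj) negb_or ax o_notin_cls.
have ac : a != c by case/andP: uabc; rewrite !inE negb_or => /andP[].
have cb : c != b by move: uabc; rewrite /= !inE [c == b]eq_sym => /and3P[].
pose P u := connect (avoiding (o c |: cls a)) (o a) u.
have PD u : P u -> u \notin o c |: cls a by apply: connect_avoiding_notin; apply: oD.
(* [u] is a vertex just before a first visit to [o c]; without such a vertex the path to [o b] would
   stay in [P]. *)
have [u Pu ocu] : exists2 u, P u & o c \in cnbr u.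
  apply/exists_inP; apply: contraR ncn => /exists_inPn H.
  suff : P (o b) by [].
  move: cab; apply: (connect_invariant (P := P)) => [u w Pu /and3P[wu ua wa]|]; last exact: connect0.
  have wc : w != o c by apply: contraTneq wu => ->; apply: H.
  apply: (connect_trans Pu (connect1 _)); rewrite /avoiding wu (PD _ Pu) /=.
  by rewrite in_setU1 negb_or wc wa.
apply: (@color_triangle L a c b) => //; try by apply: L3; rewrite // (cls_eq blb).
- by rewrite clsa -!setUA [[set b] :|: _]setUC.
- by rewrite /= !inE negb_or ac ab cb.
pose Q w := connect (avoiding (o b |: cls a)) (o a) w.
have QD w : Q w -> w \notin o b |: cls a by apply: connect_avoiding_notin; apply: oD.
have Qu : Q u.
  suff : P u /\ Q u by case.
  move: Pu; apply: (connect_invariant (P := fun w => P w /\ Q w)); last by split; apply: connect0.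
  move=> w x [Pw Qw] wx; have Px : P x by apply: connect_trans Pw (connect1 wx).
  split=> //; case/and3P: wx => wx _ _; apply: (connect_trans Qw (connect1 _)).
  rewrite /avoiding wx (QD _ Qw) in_setU1 negb_or /=.
  have := PD _ Px; rewrite in_setU1 negb_or => /andP[_ ->]; rewrite andbT.
  by apply: contraNneq ncn => <-.
apply: (connect_trans Qu (connect1 _)); rewrite /avoiding ocu (QD _ Qu) /=.
by rewrite in_setU1 (inj_eq o_inj) negb_or cb o_notin_cls.
Qed.

(** Meant for classes of size two, where it is the other end of the diamond. *)
Definition mate v := odflt v [pick u in cls v :\ v].

Lemma mateP v : #|cls v| = 2 ->
  [/\ bl (mate v) = bl v, mate v != v & forall u, bl u = bl v -> u != v -> u = mate v].
Proof.
rewrite (cardsD1 v) cls_refl => -[] /eqP/cards1P[w wE].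
have -> : mate v = w.
  rewrite /mate; case: pickP => [u|/(_ w)]; rewrite wE ?set11 // inE.
  by move/eqP.
have : w \in cls v :\ v by rewrite wE set11.
rewrite !inE => /andP[wv /eqP blw]; split=> // u blu uv.
by apply/set1P; rewrite -wE !inE uv blu eqxx.
Qed.

Lemma mateK v : #|cls v| = 2 -> mate (mate v) = v.
Proof.
move=> c2; have [blm mv _] := mateP c2.
have [_ _ H] := @mateP (mate v) (etrans (congr1 (fun A : {set V} => #|A|) (cls_eq blm)) c2).
by rewrite -(H v) // eq_sym.
Qed.

Lemma cls_123 v : [\/ #|cls v| = 1, #|cls v| = 2 | #|cls v| = 3].
Proof.
case: #|cls v| (cls_gt0 v) (cls_le3 v) => [|[|[|[|n]]]] // _ _; by [exact: Or31|exact: Or32|exact: Or33].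
Qed.

Lemma even_mates A : {in A, forall v, #|cls v| = 2 /\ mate v \in A} -> ~~ odd #|A|.
Proof.
move=> HA; apply: (@even_card_involution _ _ mate) => v /HA[c2 mA].
by split=> //; [exact: mateK|case: (mateP c2)].
Qed.

(* A minimal component, among those without a size-one class, of the
   complement of a triangle contains another triangle by parity, and that
   triangle cuts off a smaller component. *)
Lemma exists_triangle_on_cycle :
  {in [pred l | #|cls l| == 1] &, forall l l', l = l'} ->
  (exists a, #|cls a| = 3) ->
  exists a b, [/\ #|cls a| = 3, bl b = bl a, a != b & o b \in comp a].
Proof.
move=> leaf1 [a0 c3a0].
have [/existsP[a /existsP[b /and4P[/eqP ? /eqP ? ? ?]]]|/existsPn N] :=
  boolP [exists a, exists b, [&& #|cls a| == 3, bl b == bl a, a != b & o b \in comp a]].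
  by exists a, b.
have {}N a b : #|cls a| = 3 -> bl b = bl a -> a != b -> o b \notin comp a.
  by move=> c3 blb ab; have /existsPn/(_ b) := N a; rewrite c3 blb ab !eqxx.
have disj a b u : #|cls a| = 3 -> bl b = bl a -> a != b -> u \in comp a -> u \notin comp b.
  move=> c3 blb ab ua; apply/negP=> ub; have /negP[] := N _ _ c3 blb ab.
  move: ua ub; rewrite !inE (cls_eq blb) => ua ub.
  by apply: connect_trans ua _; rewrite connect_avoiding_sym.
have other a : #|cls a| = 3 -> exists2 b, bl b = bl a & a != b.
  rewrite (cardsD1 a) cls_refl add1n => -[c2].
  have /card_gt0P[b] : 0 < #|cls a :\ a| by rewrite c2.
  by rewrite !inE => /andP[ba /eqP E]; exists b; rewrite // eq_sym.
pose good a := (#|cls a| == 3) && [forall l in comp a, #|cls l| != 1].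
have [a1 ga1] : exists a, good a.
  (* At most one exit is a leaf, and the components behind two exits of a triangle are disjoint, so
     one of them has no leaf. *)
  have [|/forall_inPn[l la0]] := boolP [forall l in comp a0, #|cls l| != 1].
    by exists a0; rewrite /good c3a0.
  rewrite negbK => cl; have [b blb ab] := other a0 c3a0.
  exists b; rewrite /good (cls_eq blb) c3a0 eqxx; apply/forall_inP=> l' l'b.
  apply/negP=> cl'; have := disj _ _ _ c3a0 blb ab la0.
  by rewrite (leaf1 l l') ?l'b.
case: (@arg_minnP _ a1 good (fun a => #|comp a|) ga1) => a /andP[/eqP c3 /forall_inP nl] amin.
have [s0 s0a c3s0] : exists2 s, s \in comp a & #|cls s| = 3.
  (* If the component consisted of diamonds only, [mate] would make its size even, whereas [o]
     matches all of it except [o a] and makes its size odd. *)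
  apply/exists_eq_inP; apply: contraT => /exists_inPn H.
  have c2 v : v \in comp a -> #|cls v| = 2.
    by move=> va; have := nl v va; have := H v va; case: (cls_123 v) => ->.
  have /negP : ~~ odd #|comp a|.
    apply: even_mates => v va; split; first exact: c2.
    by apply: (comp_cls va); case: (mateP (c2 v va)).
  case; rewrite (cardsD1 (o a)) comp_o /=.
  apply: (@even_card_involution _ _ o) => v /setD1P[voa va].
  have ov : o v != v by apply: contraNneq (bl_o v) => ->.
  have ova : o v != a by apply: contraNneq voa => <-; rewrite oK.
  have ovcls : o v \notin cls a.
    apply/negP; rewrite inE => /eqP blov.
    by have := N a (o v) c3 blov; rewrite eq_sym ova oK va => /(_ isT).
  rewrite in_setD1 (inj_eq (can_inj oK)) oK ov; split=> //.
  apply/andP; split; first by apply: contraNneq (comp_notin_cls va) => ->; apply: cls_refl.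
  by apply: (comp_step va) ovcls; rewrite in_cnbr eqxx.
(* Choose an exit of the new triangle that does not lead back to [a]. Its component avoids the blob
   of [a], so it stays within [comp a], and it misses [s] itself. *)
have [s [bls aNs]] : exists s, bl s = bl s0 /\ a \notin comp s.
  have [as0|] := boolP (a \in comp s0); last by exists s0.
  have [s1 bls1 s01] := other s0 c3s0.
  by exists s1; split=> //; apply: disj as0.
have c3s : #|cls s| = 3 by rewrite (cls_eq bls).
have sa : s \in comp a by apply: comp_cls s0a bls.
have clsNs u : u \in comp s -> u \notin cls a.
  move=> us; apply: contra aNs; rewrite inE => /eqP blu.
  exact: comp_cls us (esym blu).
have sub u : u \in comp s -> u \in comp a.
  rewrite {1}inE => cu.
  suff : u \in comp s /\ u \in comp a by case.
  move: cu; apply: (connect_invariant (P := fun u => u \in comp s /\ u \in comp a)).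
    move=> x y [xs xa] /and3P[yx _ ys].
    have ycs : y \in comp s by apply: comp_step xs yx ys.
    by split=> //; apply: comp_step xa yx (clsNs _ ycs).
  split; first exact: comp_o.
  by apply: (comp_step sa); [rewrite in_cnbr eqxx|apply/clsNs/comp_o].
have := amin s; rewrite /good c3s eqxx /= leqNgt => /(_ _)/negP[].
  by apply/forall_inP=> l ls; apply/nl/sub.
apply: proper_card; apply/properP; split; first exact/subsetP.
by exists s => //; apply/negP=> /comp_notin_cls; rewrite cls_refl.
Qed.

(* [None], [Some false] and [Some true] stand for vertices seeing one, two and
   three colours. *)
Definition valid_types tau :=
  [/\ forall v, 1 < #|cls v| -> 1 < #|cls (o v)| -> tau v != tau (o v),
      forall u v, #|cls v| = 3 -> bl u = bl v -> u != v -> tau u != tau v &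
      forall u v, #|cls v| = 2 -> bl u = bl v -> tau u = tau v /\ tau v != None].

(** [P] selects the leaf, if any, whose type is pinned to [c], which keeps [c] away from its
    neighbour. Ends of diamonds lose type 1 and still have as many types as constraints. *)
Definition type_list (P : pred V) (c : option bool) v : {set option bool} :=
  if P v then [set c] else if #|cls v| == 2 then [set~ None] else setT.

Lemma card_type : #|{: option bool}| = 3.
Proof. by rewrite card_option card_bool. Qed.

Lemma card_type_list (P : pred V) c : (forall v, P v -> #|cls v| = 1) ->
  forall v, #|cls v| <= #|type_list P c v|.
Proof.
move=> P1 v; rewrite /type_list; case: ifP => [/P1->|_]; first by rewrite cards1.
by case: eqP => [->|_]; rewrite ?cardsC1 ?cardsT card_type.
Qed.

(** With two types left, differing from the negation of a type means being equal to it. *)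
Lemma mates_equal L tau X u v : proper_on L tau X -> #|cls v| = 2 -> bl u = bl v ->
  L u = [set~ None] -> L v = [set~ None] -> u \in X -> v \in X -> tau u = tau v.
Proof.
move=> [tauL tauP] c2 blu Lu Lv uX vX; have [->//|uv] := eqVneq u v.
have := tauP u v uX vX; rewrite in_cnbr /forbid uv blu c2 !eqxx orbT => /(_ isT).
have := tauL u uX; have := tauL v vX; rewrite Lu Lv !inE.
by case: (tau u) (tau v) => [[]|] [[]|].
Qed.

Lemma proper_valid (P : pred V) c tau : (forall v, P v -> #|cls v| = 1) ->
  proper_on (type_list P c) tau setT -> valid_types tau.
Proof.
move=> P1 tauP; have [tauL tauN] := tauP; split.
- move=> v _ _; have := tauN (o v) v (in_setT _) (in_setT _).
  by rewrite in_cnbr eqxx /forbid (negPf (bl_o v)) => /(_ isT).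
- move=> u v c3 blu uv; have := tauN u v (in_setT _) (in_setT _).
  by rewrite in_cnbr uv blu /forbid c3 eqxx orbT andbF eq_sym => /(_ isT).
move=> u v c2 blu; have L2 w : bl w = bl v -> type_list P c w = [set~ None].
  move=> blw; rewrite /type_list (cls_eq blw) c2 eqxx; case: ifP => // /P1.
  by rewrite (cls_eq blw) c2.
split; first exact: (mates_equal tauP c2 blu (L2 _ blu) (L2 _ erefl) (in_setT _) (in_setT _)).
by have := tauL v (in_setT _); rewrite L2 // !inE.
Qed.

Lemma o_neq v : o v != v.
Proof. by apply: contraNneq (bl_o v) => ->. Qed.

Lemma even_card_exits : ~~ odd #|V|.
Proof.
rewrite -cardsT; apply: (@even_card_involution _ _ o) => v _.
by rewrite in_setT oK o_neq.
Qed.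

(** The leaf [o w] is pinned to [c]. Another leaf has three types for one constraint and gives
    slack; failing that, a triangle puts some triangle on a cycle. If all other blobs were diamonds,
    the number of exits would be odd, against the matching [o]. *)
Lemma valid_types_at_leaf w c : #|cls (o w)| = 1 ->
  exists2 tau, valid_types tau & tau w != c.
Proof.
move=> leafw; pose P := pred1 (o w); pose L := type_list P c.
have P1 v : P v -> #|cls v| = 1 by move/eqP->.
have HL := card_type_list c P1.
suff [t tP] : exists tau, proper_on L tau setT.
  exists t; first exact: proper_valid P1 tP.
  have [tL tN] := tP; have := tN (o w) w (in_setT _) (in_setT _).
  have := tL (o w) (in_setT _); rewrite /L /type_list /= eqxx inE => /eqP->.
  by rewrite in_cnbr eqxx /forbid (negPf (bl_o w)) => /(_ isT).
have [/existsP[l /andP[/eqP l1 lw]]|/existsPn nl] :=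
  boolP [exists l, (#|cls l| == 1) && (l != o w)].
  apply: (@color_slack _ l) => //.
  by rewrite /L /type_list /= (negPf lw) l1 cardsT card_type.
have leafE l : #|cls l| = 1 -> l = o w.
  by move=> l1; have := nl l; rewrite l1 eqxx negbK => /eqP.
have [/existsP[a /eqP c3]|/existsPn n3] := boolP [exists a, #|cls a| == 3].
  have [||a' [b [c3' blb ab oba]]] := exists_triangle_on_cycle; first 1 last.
  - by exists a.
  - apply: color_on_cycle c3' blb ab oba => // v v3.
    by rewrite /L /type_list v3; case: ifP => // /P1; rewrite v3.
  by move=> l l'; rewrite !inE => /eqP/leafE-> /eqP/leafE->.
case/negP: even_card_exits; rewrite -cardsT (cardsD1 (o w)) in_setT /=.
apply: even_mates => v; rewrite !inE andbT => vw.
have c2 : #|cls v| = 2.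
  have := n3 v; case: (cls_123 v) => [/leafE vE| |->] //.
  by rewrite vE eqxx in vw.
have [blm _ _] := mateP c2; split=> //; rewrite andbT.
by apply/eqP=> E; have := leafw; rewrite -E (cls_eq blm) c2.
Qed.

(** All exits but [w] are coloured greedily. The last one is stuck only if [o w] and [mate w] have
    the same type, since [w] must agree with its mate. The exits of the other type are then closed
    under [mate], hence even in number, and [o] matches them with those of the first type except
    [o w]; this makes half the number of exits odd. *)
Lemma valid_types_diamonds : (forall v, #|cls v| = 2) -> ~~ odd #|V|./2 ->
  exists tau, valid_types tau.
Proof.
move=> c2 ev; have [/card0_eq V0|/card_gt0P[w _]] := posnP #|V|.
  by exists (fun=> None); split=> [v|u v|u v]; have := V0 v.
have P1 v : pred0 v -> #|cls v| = 1 by [].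
have [t tP] := color_all_but w (card_type_list None P1).
set L := type_list pred0 None in tP; have LE v : L v = [set~ None].
  by rewrite /L /type_list c2.
have [tL tN] := tP; have [blm mw mU] := mateP (c2 w).
have inX v : (v \in [set~ w]) = (v != w) by rewrite !inE.
have tsome v : v != w -> t v != None.
  by move=> vw; have := tL v; rewrite inX vw LE !inE => /(_ isT).
have [E|E] := eqVneq (t (o w)) (t (mate w)); last first.
  have [|||t' _] := @color_one L t [set~ w] w (t (mate w)) tP.
  - by rewrite inX eqxx.
  - by rewrite LE !inE tsome.
  - move=> u _; rewrite in_cnbr /forbid => /orP[/eqP->|/andP[uw /eqP blu]].
      by rewrite (negPf (bl_o w)) eq_sym.
    rewrite blu c2 !eqxx (mU u blu uw) /=.
    by have := tsome _ mw; case: (t (mate w)) => [[]|].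
  by rewrite setUCr => t'P; exists t'; apply: proper_valid P1 t'P.
pose A := [set v | (v != w) && (t v == t (mate w))].
pose A' := [set v | (v != w) && (t v != t (mate w))].
have mate_t v : v != w -> mate v != w -> t (mate v) = t v.
  move=> vw mvw; have [blv _ _] := mateP (c2 v).
  by apply: (mates_equal tP (c2 v) blv); rewrite ?LE ?inX.
have o_t v : v != w -> o v != w -> (t (o v) == t (mate w)) = (t v != t (mate w)).
  move=> vw ovw; have := tN (o v) v; rewrite !inX in_cnbr eqxx vw ovw => /(_ isT isT isT).
  rewrite /forbid (negPf (bl_o v)) /=.
  have := tsome _ vw; have := tsome _ ovw; have := tsome _ mw.
  by case: (t v) (t (o v)) (t (mate w)) => [[]|] [[]|] [[]|].
have mA : mate w \in A by rewrite inE mw eqxx.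
have oA : o w \in A by rewrite inE o_neq E eqxx.
have evA' : ~~ odd #|A'|.
  apply: even_mates => v; rewrite inE => /andP[vw tv]; split=> //.
  have mvw : mate v != w by apply: contraNneq tv => <-; rewrite mateK.
  by rewrite inE mvw mate_t.
have evA : ~~ odd #|A :\ mate w|.
  apply: even_mates => v; rewrite !inE => /and3P[vmw vw tv]; split=> //.
  have mvw : mate v != w by apply: contraNneq vmw => <-; rewrite mateK.
  rewrite mvw mate_t // tv !andbT.
  by apply: contraNneq vw => /(congr1 mate); rewrite !mateK // => ->.
have AA' : #|A'| = #|A :\ o w|.
  have -> : A' = o @: (A :\ o w); last by rewrite card_imset //; apply: can_inj oK.
  apply/setP=> v; apply/idP/imsetP => [|[x]].
    rewrite inE => /andP[vw tv]; exists (o v); rewrite ?oK //.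
    have ovw : o v != w by apply: contraNneq tv => ovw; rewrite -E -ovw oK.
    by rewrite !inE (inj_eq (can_inj oK)) vw ovw o_t.
  rewrite !inE => /and3P[xow xw tx] ->.
  have oxw : o x != w by apply: contraNneq xow => <-; rewrite oK.
  by rewrite oxw -(negbK (_ == _)) -o_t ?oK // tx.
have cV : #|V| = 1 + (#|A| + #|A'|).
  rewrite -cardsT (cardsD1 w) in_setT; congr (_ + _).
  rewrite -(cardsID [set v | t v == t (mate w)]); congr (_ + _); apply: eq_card => v.
    by rewrite !inE andbT.
  by rewrite !inE andbT andbC.
have := cardsD1 (o w) A; rewrite oA -AA' => cA.
case/negP: ev; have -> : #|V| = #|A'|.+1.*2.
  by rewrite cV cA doubleS -addnn !add1n addSn.
by rewrite doubleK.
Qed.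

Lemma exists_valid_types :
  ((forall v, #|cls v| = 2) -> ~~ odd #|V|./2) -> exists tau, valid_types tau.
Proof.
move=> ev; have [/existsP[l /eqP l1]|/existsPn n1] := boolP [exists l, #|cls l| == 1].
  have [|t tP _] := @valid_types_at_leaf (o l) None; last by exists t.
  by rewrite oK.
have [/existsP[a /eqP c3]|/existsPn n3] := boolP [exists a, #|cls a| == 3]; last first.
  have c2 v : #|cls v| = 2 by have := n1 v; have := n3 v; case: (cls_123 v) => ->.
  by apply: valid_types_diamonds (ev c2).
have [||a' [b [c3' blb ab oba]]] := exists_triangle_on_cycle; first 1 last.
- by exists a.
- have P1 v : pred0 v -> #|cls v| = 1 by [].
  have [v v3|t tP] := color_on_cycle (card_type_list None P1) _ c3' blb ab oba.
    by rewrite /type_list v3.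
  by exists t; apply: proper_valid P1 tP.
by move=> l l'; rewrite inE (negPf (n1 l)).
Qed.

(** The exits of type 3 are paired by [mate], and [o] exchanges them with the exits of type 2; so
    they are even in number and make up half of all exits. *)
Lemma valid_types_even_diamonds tau : (forall v, #|cls v| = 2) -> valid_types tau ->
  ~~ odd #|V|./2.
Proof.
move=> c2 [tauo _ tau2]; pose A := [set v | tau v == Some true].
have evA : ~~ odd #|A|.
  apply: even_mates => v; rewrite !inE => tv; have [blm _ _] := mateP (c2 v).
  by split=> //; have [-> _] := tau2 _ _ (c2 v) blm.
suff -> : #|V|./2 = #|A| by [].
have cA : #|~: A| = #|A|.
  have -> : ~: A = o @: A; last by rewrite card_imset //; apply: can_inj oK.
  have oA v : (o v \in A) = (v \notin A).
    rewrite !inE; have := tauo v; rewrite !c2 => /(_ isT isT).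
    have [_] := tau2 _ _ (c2 v) erefl; have [_] := tau2 _ _ (c2 (o v)) erefl.
    by case: (tau v) (tau (o v)) => [[]|] [[]|].
  apply/setP=> v; apply/idP/imsetP => [|[x xA ->]].
    by rewrite inE -oA => ?; exists (o v); rewrite ?oK.
  by rewrite inE oA negbK.
by rewrite -(cardsC A) cA addnn doubleK.
Qed.

(** * Colours of the outer edges *)

(** Its value is significant for triangles, where at most one exit has type 3; the default only
    makes the function total. *)
Definition rainbow_of tau v := odflt v [pick u in cls v | tau u == Some true].

Lemma rainbow_ofE tau u v : valid_types tau -> #|cls v| = 3 -> bl u = bl v ->
  tau v = Some true -> rainbow_of tau u = v.
Proof.
move=> [_ tau3 _] c3 blu tv; rewrite /rainbow_of; case: pickP => [w|/(_ v)].
  rewrite inE => /andP[/eqP blw /eqP tw]; apply/eqP; apply: contraT => wv.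
  by have := tau3 w v c3 (etrans blw blu) wv; rewrite tw tv.
by rewrite inE blu eqxx tv.
Qed.

(* The colours of the outer edges at rainbow triangle vertices only have to
   respect one constraint each, namely with respect to the triangle that the
   edge leads to; the other outer edges are then coloured independently. *)
Lemma exists_outer_colors tau : valid_types tau ->
  exists k : V -> 'I_3,
  [/\ forall v, k (o v) = k v,
      forall u v, #|cls v| = 3 -> bl u = bl v -> u != v -> tau v = Some true -> k u != k v &
      forall u v, #|cls v| = 2 -> bl u = bl v -> tau v = Some true -> k u = k v].
Proof.
move=> tauP; have [tauo tau3 tau2] := tauP.
pose rv := rainbow_of tau.
have [rho rhoP] := functional_graph_3_coloring (fun v => rv (o v)).
(* Leaves are left out because [valid_types] does not compare the type of a leaf with that of its
   neighbour. Thus at most one end of an outer edge satisfies [isR]. *)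
pose isR v := (tau v == Some true) && (1 < #|cls v|).
(* At a triangle, [rho] already differs from the colour at the rainbow vertex that the edge leads
   to. A diamond of type 3 has two edges of the same colour, which must avoid the rainbow vertices
   at both far ends. *)
pose sR v := if #|cls v| == 3 then rho v else
  avoid (rho (rv (o v))) (rho (rv (o (mate v)))).
pose k v := if isR v then sR v else if isR (o v) then sR (o v) else
  avoid (rho (rv v)) (rho (rv (o v))).
have isRo v : isR v -> isR (o v) = false.
  case/andP=> /eqP tv c1; apply/negP=> /andP[/eqP tov c1o].
  by have := tauo v c1 c1o; rewrite tv tov eqxx.
exists k; split.
- move=> v; rewrite /k oK; case: ifP => [/isRo|_]; last by rewrite avoidC.
  by rewrite oK => ->.
- move=> u v c3 blu uv tv.
  have rvu : rv u = v by apply: rainbow_ofE.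
  have -> : k v = rho v by rewrite /k /isR /sR c3 tv.
  have nRu : isR u = false.
    by have := tau3 _ _ c3 blu uv; rewrite tv /isR => /negPf->.
  rewrite /k nRu; case: ifP => [Rou|_]; last by rewrite rvu; case: (avoidP (rho v) (rho (rv (o u)))).
  rewrite /sR; case: ifP => _.
    have := rhoP (o u); rewrite oK rvu => -> //.
    by apply: contraNneq (bl_o u) => <-; rewrite blu.
  by rewrite oK rvu; case: (avoidP (rho v) (rho (rv (o (mate (o u)))))).
move=> u v c2 blu tv; have [->//|uv] := eqVneq u v.
have c2u : #|cls u| = 2 by rewrite (cls_eq blu).
have tu : tau u = Some true by have [-> _] := tau2 u v c2 blu.
have [_ _ mv] := mateP c2; have [_ _ mu] := mateP c2u.
rewrite /k /isR /sR tu tv c2 c2u /= -(mv u) // -(mu v) // 1?eq_sym //.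
exact: avoidC.
Qed.

End Exits.

(** * Blobs of the graph *)

Section Blobs.

Variables (T : finType) (e : rel T).
Hypothesis simple_e : simple_graph e.
Hypothesis connected_e : connected_graph e.
Hypothesis degree_1_or_3 : forall v : T, degree e v = 1 \/ degree e v = 3.
Hypothesis three_cycle_deg3 : forall v : T, degree e v = 3 -> in_three_cycle e v.

Definition common u w := [exists z, e u z && e w z].
(* An edge is inner if it lies in a triangle; the blobs are the connected
   components of the inner edges. *)
Definition outer u w := e u w && ~~ common u w.
Definition inner u w := e u w && common u w.
Definition exit v := [exists w, outer v w].

Lemma e_sym : symmetric e.
Proof. by case: simple_e. Qed.

Lemma e_irr : irreflexive e.
Proof. by case: simple_e. Qed.

Lemma e_neq u w : e u w -> u != w.
Proof. by apply: contraTneq => ->; rewrite e_irr. Qed.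

Lemma common_sym u w : common u w = common w u.
Proof. by apply: eq_existsb => z; rewrite andbC. Qed.

Lemma outer_sym : symmetric outer.
Proof. by move=> u w; rewrite /outer e_sym common_sym. Qed.

Lemma inner_sym : symmetric inner.
Proof. by move=> u w; rewrite /inner e_sym common_sym. Qed.

Lemma inner_connect_sym : connect_sym inner.
Proof. exact/sym_connect_sym/inner_sym. Qed.

Lemma outer_or_inner u w : e u w = outer u w || inner u w.
Proof. by rewrite /outer /inner; case: (e u w); case: (common u w). Qed.

Lemma common_triangle u w z : e u z -> e w z -> common u w.
Proof. by move=> uz wz; apply/existsP; exists z; rewrite uz. Qed.

Lemma graph_closed (P : pred T) x : P x -> (forall u w, P u -> e u w -> P w) ->
  forall y, P y.
Proof.
move=> Px step y; have [_ conn] := connected_e.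
exact: (connect_invariant (P := P)) Px (conn x y).
Qed.

Lemma deg3_nbrs v x y z : degree e v = 3 -> uniq [:: x; y; z] ->
  e v x -> e v y -> e v z -> forall u, e v u = (u \in [:: x; y; z]).
Proof.
move=> d3 U vx vy vz u.
have sub : [set u in [:: x; y; z]] \subset [set u | e v u].
  by apply/subsetP=> w; rewrite !inE => /or3P[]/eqP->.
have /eqP E : [set u in [:: x; y; z]] == [set u | e v u].
  rewrite eqEcard sub; move: d3; rewrite /degree => ->.
  by rewrite cardsE (card_uniqP U).
by move/setP: E => /(_ u); rewrite [RHS]inE inE => ->.
Qed.

Lemma deg3_third v x y : degree e v = 3 -> x != y -> e v x -> e v y ->
  exists2 z, uniq [:: x; y; z] & forall u, e v u = (u \in [:: x; y; z]).
Proof.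
move=> d3 xy vx vy.
have /card_gt0P[z] : 0 < #|[set u | e v u] :\ x :\ y|.
  move: d3; rewrite /degree (cardsD1 x) inE vx (cardsD1 y) !inE eq_sym xy vy.
  by rewrite !add1n => -[->].
rewrite !inE => /and3P[zy zx vz].
have U : uniq [:: x; y; z] by rewrite /= !inE negb_or xy ![_ == z]eq_sym zx zy.
by exists z => //; apply: deg3_nbrs.
Qed.

Lemma deg1_nbr v : degree e v = 1 -> exists w, forall u, e v u = (u == w).
Proof.
by move/eqP/cards1P=> [w /setP E]; exists w => u; have := E u; rewrite !inE.
Qed.

Lemma deg3_triangle v : degree e v = 3 ->
  exists b c, [/\ e v b, e v c, e b c & b != c].
Proof.
case/three_cycle_deg3=> [a [b [c []]]]; rewrite /ucycle /= !inE !negb_or !andbT.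
case/andP=> /and3P[ab bc ca] /andP[/andP[nab nac] nbc] /or3P[] /eqP->.
- by exists b, c; rewrite ab bc e_sym ca.
- by exists a, c; rewrite e_sym ab bc e_sym ca.
by exists a, b; rewrite ca e_sym bc ab.
Qed.

Lemma two_nbrs_deg3 v x y : e v x -> e v y -> x != y -> degree e v = 3.
Proof.
move=> vx vy xy; have [/deg1_nbr[w wE]|//] := degree_1_or_3 v.
by move: vx vy xy; rewrite !wE => /eqP-> /eqP->; rewrite eqxx.
Qed.

(** The 3-cycle through [v] takes two of its three edges and cannot contain [w], so all edges at [v]
    but one are inner. *)
Lemma exit_deg3 v w : degree e v = 3 -> outer v w ->
  exists b c, [/\ e b c, uniq [:: w; b; c], forall u, e v u = (u \in [:: w; b; c]),
    forall u, inner v u = (u \in [:: b; c]) & forall u, outer v u = (u == w)].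
Proof.
move=> d3 vw; have [b [c [vb vc bc nbc]]] := deg3_triangle d3.
have ib : common v b by apply: common_triangle vc bc.
have ic : common v c by apply: common_triangle vb _; rewrite e_sym.
have [evw cvw] := andP vw.
have wb : w != b by apply: contraNneq cvw => ->.
have wc : w != c by apply: contraNneq cvw => ->.
have U : uniq [:: w; b; c] by rewrite /= !inE negb_or wb wc nbc.
have N := deg3_nbrs d3 U evw vb vc; exists b, c; split=> // u.
  rewrite /inner N !inE; have [->|uw] /= := eqVneq u w.
    by rewrite (negPf cvw) (negPf wb) (negPf wc).
  by have [->|ub] //= := eqVneq u b; have [->|uc] := eqVneq u c.
rewrite /outer N !inE; have [->|uw] /= := eqVneq u w; first by rewrite cvw.
by have [->|ub] /= := eqVneq u b; rewrite ?ib //; have [->|uc] //= := eqVneq u c; rewrite ic.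
Qed.

Lemma leaf_exit v w : degree e v = 1 -> e v w -> outer v w.
Proof.
move=> /deg1_nbr[z zE] vw; rewrite /outer vw; apply/existsPn=> x.
by move: vw; rewrite !zE => /eqP->; have [->|] //= := eqVneq x z; rewrite e_irr.
Qed.

Lemma leaf_outer v w u : degree e v = 1 -> outer v w -> outer v u -> u = w.
Proof.
by move=> /deg1_nbr[z zE] /andP[vw _] /andP[vu _]; move: vw vu; rewrite !zE => /eqP-> /eqP.
Qed.

Lemma leaf_inner v u : degree e v = 1 -> inner v u = false.
Proof.
move=> d1; apply/negP=> /andP[vu c]; have /andP[_] := leaf_exit d1 vu.
by rewrite c.
Qed.

Lemma outer_uniq v w u : outer v w -> outer v u -> u = w.
Proof.
have [d1|d3] := degree_1_or_3 v; first exact: leaf_outer.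
by move=> vw; have [b [c [_ _ _ _ ->]]] := exit_deg3 d3 vw; move/eqP.
Qed.

Lemma nonexit_deg3 v : ~~ exit v -> degree e v = 3.
Proof.
move=> nx; have [d1|//] := degree_1_or_3 v; have [w wE] := deg1_nbr d1.
by case/existsP: nx; exists w; apply: leaf_exit; rewrite // wE.
Qed.

(** A 3-cycle covers two of the edges at [p]. The third is inner too, so its end is adjacent to one
    of the other two neighbours, and that one is [q]. *)
Lemma nonexit_struct p : ~~ exit p ->
  exists q x y, [/\ uniq [:: q; x; y], forall u, e p u = (u \in [:: q; x; y]),
    e q x & e q y].
Proof.
move=> nx; have d3 := nonexit_deg3 nx; have [b [c [pb pc bc nbc]]] := deg3_triangle d3.
have [d U N] := deg3_third d3 nbc pb pc.
have pd : e p d by rewrite N !inE eqxx !orbT.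
have : common p d.
  by have /existsPn/(_ d) := nx; rewrite /outer pd negbK.
case/existsP=> z /andP[]; rewrite N !inE => /or3P[]/eqP-> dz.
- by exists b, c, d; split=> //; rewrite e_sym.
- exists c, b, d; split; rewrite 1?e_sym //.
    by move: U; rewrite /= !inE !negb_or eq_sym => /and3P[/andP[-> ->] -> _].
  by move=> u; rewrite N !inE orbCA.
by rewrite e_irr in dz.
Qed.

Definition triangle_blob a b c :=
  [/\ uniq [:: a; b; c], e a b, e a c, e b c & [/\ exit a, exit b & exit c]].

(** The centres [p], [q] span the shared edge, and [x], [y] are the ends. Unlike [diamond], this is
    an induced subgraph, and its exits are exactly the ends. *)
Definition diamond_blob p q x y :=
  [/\ uniq [:: p; q; x; y], [/\ e p q, e p x, e p y, e q x & e q y],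
      ~~ e x y & [/\ ~~ exit p, ~~ exit q, exit x & exit y]].

(** The third edge at [x] is outer: its other end is adjacent neither to [p] nor to [q], whose
    neighbourhoods are full. *)
Lemma diamond_end_exit p q x y : e p q -> e p x -> e q x -> ~~ e x y ->
  (forall u, e p u = (u \in [:: q; x; y])) -> (forall u, e q u = (u \in [:: p; x; y])) ->
  exit x.
Proof.
move=> pq px qx nxy Np Nq; have nepq := e_neq pq.
have xp : e x p by rewrite e_sym.
have xq : e x q by rewrite e_sym.
have [z U N] := deg3_third (two_nbrs_deg3 xp xq nepq) nepq xp xq.
have xz : e x z by rewrite N !inE eqxx !orbT.
have zx := e_neq xz; rewrite eq_sym in zx.
have zy : z != y by apply: contraNneq nxy => <-.
have [zp zq] : z != p /\ z != q.
  by move: U; rewrite /= !inE negb_or ![_ == z]eq_sym => /and3P[/andP[_ ->] -> _].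
apply/existsP; exists z; rewrite /outer xz; apply/existsPn=> w; rewrite N !inE.
apply/negP=> /andP[/or3P[]/eqP->]; rewrite ?e_irr // e_sym ?Np ?Nq !inE.
  by rewrite (negPf zq) (negPf zx) (negPf zy).
by rewrite (negPf zp) (negPf zx) (negPf zy).
Qed.

Lemma center_nbrs p q x y : uniq [:: q; x; y] ->
  (forall u, e p u = (u \in [:: q; x; y])) -> e q x -> e q y ->
  [/\ e p q, e p x, e p y, p \notin [:: q; x; y] &
      forall u, e q u = (u \in [:: p; x; y])].
Proof.
move=> U N qx qy.
have pq : e p q by rewrite N !inE eqxx.
have px : e p x by rewrite N !inE eqxx orbT.
have py : e p y by rewrite N !inE eqxx !orbT.
have xy : x != y by move: U; rewrite /= !inE => /and3P[].
have pN : p \notin [:: q; x; y] by rewrite -N e_irr.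
split=> //; apply: deg3_nbrs; rewrite // 1?e_sym //.
  exact: two_nbrs_deg3 qx qy xy.
by move: pN; rewrite /= !inE !negb_or => /and3P[_ -> ->]; rewrite xy.
Qed.

(** If the ends are adjacent, all four vertices have their full degree among themselves, and by
    connectedness there are no others. *)
Lemma center_diamond_or_K4 p : ~~ exit p ->
  (exists q x y, diamond_blob p q x y) \/
  (exists q x y, [/\ uniq [:: p; q; x; y], [/\ e p q, e p x, e p y, e q x & e q y], e x y &
     forall u, u \in [:: p; q; x; y]]).
Proof.
move=> nx; have [q [x [y [U N qx qy]]]] := nonexit_struct nx.
have [pq px py pN Nq] := center_nbrs U N qx qy.
have U4 : uniq [:: p; q; x; y] by rewrite cons_uniq pN.
have [exy|nexy] := boolP (e x y); [right|left]; exists q, x, y.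
  split=> //; apply: (graph_closed (x := p)) => [|u w]; first by rewrite inE eqxx.
  have xyn := e_neq exy.
  have [pq' px' py'] : [/\ p != q, p != x & p != y] by rewrite !e_neq.
  have [qx' qy'] : q != x /\ q != y by rewrite !e_neq.
  have Nx : forall u, e x u = (u \in [:: p; q; y]).
    have xp : e x p by rewrite e_sym.
    have xq : e x q by rewrite e_sym.
    apply: deg3_nbrs => //; first exact: two_nbrs_deg3 xp xq pq'.
    by rewrite /= !inE negb_or pq' py' qy'.
  have Ny : forall u, e y u = (u \in [:: p; q; x]).
    have yp : e y p by rewrite e_sym.
    have yq : e y q by rewrite e_sym.
    apply: deg3_nbrs => //; rewrite 1?e_sym //; first exact: two_nbrs_deg3 yp yq pq'.
    by rewrite /= !inE negb_or pq' px' qx'.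
  rewrite !inE => /or4P[]/eqP->; rewrite ?N ?Nq ?Nx ?Ny !inE;
    by move=> /or3P[] ->; rewrite ?orbT.
have nq : ~~ exit q.
  apply/existsPn=> w; rewrite /outer Nq !inE.
  apply/negP=> /andP[/or3P[]/eqP->]; case/negP.
  - by apply: common_triangle qx px.
  - by apply: (common_triangle (z := p)); rewrite e_sym.
  by apply: (common_triangle (z := p)); rewrite e_sym.
split=> //; split=> //; first exact: diamond_end_exit pq px qx nexy N Nq.
apply: (diamond_end_exit (x := y) (y := x) pq) => //; first by rewrite e_sym.
  by move=> u; rewrite N !inE; congr (_ || _); rewrite orbC.
by move=> u; rewrite Nq !inE; congr (_ || _); rewrite orbC.
Qed.

Hypothesis exit_exists : exists v, exit v.

(** K4 has no outer edge, so an exit anywhere rules it out. *)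
Lemma center_diamond p : ~~ exit p -> exists q x y, diamond_blob p q x y.
Proof.
case/center_diamond_or_K4=> // -[q [x [y [U [pq px py qx qy] xy A]]]].
have [v /existsP[w /andP[vw /existsPn N]]] := exit_exists.
have [qp xp yp xq yq] : [/\ e q p, e x p, e y p, e x q & e y q] by split; rewrite e_sym.
have yx : e y x by rewrite e_sym.
move: (A v) (A w) vw (N p) (N q) (N x) (N y); rewrite !inE.
by move=> /or4P[]/eqP-> /or4P[]/eqP->; rewrite ?e_irr ?(pq, px, py, qx, qy, qp, xp, yp, xq, yq, xy, yx).
Qed.

(** Two inner neighbours that are exits form a triangle blob with [v]; a non-exit among them is the
    centre of a diamond with end [v]. *)
Lemma exit_cases v : exit v ->
  [\/ degree e v = 1, exists b c, triangle_blob v b c | exists p q y, diamond_blob p q v y].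
Proof.
move=> xv; have /existsP[w vw] := xv.
have [|d3] := degree_1_or_3 v; first by constructor 1.
have [b [c [bc U N I _]]] := exit_deg3 d3 vw.
have vb : e v b by rewrite N !inE eqxx orbT.
have vc : e v c by rewrite N !inE eqxx !orbT.
have dia p : e v p -> ~~ exit p -> exists p q y, diamond_blob p q v y.
  move=> vp np; have [q [x [y [U4 [pq px py qx qy] nxy [_ nq xx xy]]]]] := center_diamond np.
  have Np : e p v = (v \in [:: q; x; y]).
    apply: deg3_nbrs => //; first exact: two_nbrs_deg3 pq px (e_neq qx).
    by case/andP: U4.
  move: Np; rewrite e_sym vp !inE => /esym/or3P[]/eqP vE.
  - by rewrite vE (negPf nq) in xv.
  - by exists p, q, y; rewrite vE.
  exists p, q, x; rewrite vE; split=> //; last by rewrite e_sym.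
  move: U4; rewrite /= !inE !negb_or [y == x]eq_sym.
  by case/and4P=> [/and3P[-> -> ->] /andP[-> ->] -> _].
have [xb|nb] := boolP (exit b); last by constructor 3; apply: dia nb.
have [xc|nc] := boolP (exit c); last by constructor 3; apply: dia nc.
constructor 2; exists b, c; split=> //.
by rewrite /= !inE negb_or e_neq // e_neq // e_neq.
Qed.

(** * Inner components of leaves, triangles and diamonds *)

Lemma connect_inner_leaf v u : degree e v = 1 -> connect inner v u -> u = v.
Proof.
move=> d1; apply: (connect_invariant (P := fun u => u = v)) => // x y -> /=.
by rewrite leaf_inner.
Qed.

Lemma triangle_inner a b c u : triangle_blob a b c -> inner a u = (u \in [:: b; c]).
Proof.
case=> U ab ac bc [/existsP[w aw] _ _].
have nbc : b != c by move: U; rewrite /= !inE => /and3P[].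
have [b' [c' [_ _ N I _]]] := exit_deg3 (two_nbrs_deg3 ab ac nbc) aw.
have ib : inner a b by rewrite /inner ab; apply: common_triangle ac bc.
have ic : inner a c by rewrite /inner ac; apply: common_triangle ab _; rewrite e_sym.
move: ib ic nbc; rewrite !I !inE; do 2![case/orP=> /eqP->]; rewrite ?eqxx //.
by rewrite orbC.
Qed.

Lemma triangle_perm a b c : triangle_blob a b c -> triangle_blob b c a /\ triangle_blob a c b.
Proof.
case=> U ab ac bc [xa xb xc]; move: U; rewrite /= !inE !negb_or !andbT => /andP[/andP[nab nac] nbc].
have U1 : uniq [:: b; c; a] by rewrite /= !inE !negb_or nbc ![_ == a]eq_sym nab nac.
have U2 : uniq [:: a; c; b] by rewrite /= !inE !negb_or nac nab eq_sym nbc.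
by split; split; rewrite // e_sym.
Qed.

Lemma connect_inner_triangle a b c u : triangle_blob a b c ->
  connect inner a u = (u \in [:: a; b; c]).
Proof.
move=> t; have [t1 t2] := triangle_perm t; have [t3 _] := triangle_perm t1.
apply/idP/idP.
  apply: (connect_invariant (P := fun u => u \in [:: a; b; c])); last by rewrite inE eqxx.
  move=> x y; rewrite !inE => /or3P[]/eqP->;
    by rewrite (triangle_inner _ t, triangle_inner _ t1, triangle_inner _ t3) !inE => /orP[]->; rewrite ?orbT.
rewrite !inE => /or3P[]/eqP->; rewrite ?connect0 //; apply: connect1.
  by rewrite (triangle_inner _ t) !inE eqxx.
by rewrite (triangle_inner _ t) !inE eqxx orbT.
Qed.

Lemma diamond_nbrs p q x y : diamond_blob p q x y ->
  (forall u, e p u = (u \in [:: q; x; y])) /\ (forall u, e q u = (u \in [:: p; x; y])).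
Proof.
case=> U [pq px py qx qy] _ _; move: U; rewrite /= !inE !negb_or !andbT.
case/and3P=> /and3P[npq npx npy] /andP[nqx nqy] nxy.
have qp : e q p by rewrite e_sym.
split; first apply: (deg3_nbrs (two_nbrs_deg3 px py nxy) _ pq px py).
  by rewrite /= !inE negb_or nqx nqy nxy.
apply: (deg3_nbrs (two_nbrs_deg3 qx qy nxy) _ qp qx qy).
by rewrite /= !inE negb_or npx npy nxy.
Qed.

Lemma diamond_inner p q x y : diamond_blob p q x y ->
  [/\ forall u, inner p u = (u \in [:: q; x; y]),
      forall u, inner q u = (u \in [:: p; x; y]),
      forall u, inner x u = (u \in [:: p; q]) &
      forall u, inner y u = (u \in [:: p; q])].
Proof.
move=> d; have [Np Nq] := diamond_nbrs d.
case: d => U [pq px py qx qy] nxy [np nq /existsP[x' xx'] /existsP[y' yy']].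
have npq := e_neq pq.
have center r u : ~~ exit r -> inner r u = e r u.
  by move=> /existsPn/(_ u) no; rewrite outer_or_inner (negPf no).
have fin z z' : outer z z' -> e p z -> e q z -> forall u, inner z u = (u \in [:: p; q]).
  move=> zz' pz qz; have zp : e z p by rewrite e_sym.
  have zq : e z q by rewrite e_sym.
  have [b [c [_ _ N I _]]] := exit_deg3 (two_nbrs_deg3 zp zq npq) zz'.
  have ip : inner z p by rewrite /inner zp; apply: common_triangle zq pq.
  have iq : inner z q by rewrite /inner zq; apply: common_triangle zp _; rewrite e_sym.
  move=> u; move: ip iq npq; rewrite !I !inE; do 2![case/orP=> /eqP->]; rewrite ?eqxx //.
  by rewrite orbC.
by split=> [u|u||]; rewrite ?center //; [apply: fin xx' _ _|apply: fin yy' _ _].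
Qed.

Lemma connect_inner_diamond p q x y u : diamond_blob p q x y ->
  connect inner p u = (u \in [:: p; q; x; y]).
Proof.
move=> d; have [Ip Iq Ix Iy] := diamond_inner d; apply/idP/idP.
  apply: (connect_invariant (P := fun u => u \in [:: p; q; x; y])); last by rewrite inE eqxx.
  move=> v w; rewrite !inE => /or4P[]/eqP->; rewrite ?Ip ?Iq ?Ix ?Iy !inE.
  - by move=> /or3P[]->; rewrite ?orbT.
  - by move=> /or3P[]->; rewrite ?orbT.
  - by move=> /orP[]->; rewrite ?orbT.
  by move=> /orP[]->; rewrite ?orbT.
by rewrite !inE => /or4P[]/eqP->; rewrite ?connect0 // connect1 // Ip !inE eqxx ?orbT.
Qed.

(** * The exits, their matching and their blobs *)

Definition exitT := {v : T | exit v}.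

Definition outer_nbr (v : exitT) : exitT :=
  insubd v (odflt (val v) [pick w | outer (val v) w]).

(** The inner component is named by its canonical root, so that blobs can be compared by equality in
    [T]. *)
Definition blob (v : exitT) : T := root inner (val v).

Notation cls := (cls blob).

Lemma outer_outer_nbr v : outer (val v) (val (outer_nbr v)).
Proof.
rewrite /outer_nbr; case: pickP => [w vw|none].
  by rewrite val_insubd ifT //; apply/existsP; exists (val v); rewrite outer_sym.
by have /existsP[w] := valP v; rewrite none.
Qed.

Lemma outer_nbrP (v w : exitT) : outer (val v) (val w) -> outer_nbr v = w.
Proof. by move=> vw; apply/val_inj/(outer_uniq vw)/outer_outer_nbr. Qed.

Lemma outer_nbrK : involutive outer_nbr.
Proof. by move=> v; apply: outer_nbrP; rewrite outer_sym outer_outer_nbr. Qed.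

Lemma blobE u v : (blob u == blob v) = connect inner (val u) (val v).
Proof. exact/root_connect/inner_connect_sym. Qed.

(** Two vertices of a blob are joined by an inner edge, except the two ends of a diamond, which are
    not adjacent at all. *)
Lemma blob_outer_nbr v : blob (outer_nbr v) != blob v.
Proof.
rewrite eq_sym blobE; have /andP[ev nc] := outer_outer_nbr v.
have ni u : val (outer_nbr v) = u -> inner (val v) u = false.
  by move=> <-; rewrite /inner (negPf nc) andbF.
have nv : (val (outer_nbr v) == val v) = false by rewrite eq_sym (negPf (e_neq ev)).
case: (exit_cases (valP v)) => [d1|[b [c t]]|[p [q [y d]]]].
- by apply/negP=> /(connect_inner_leaf d1)/eqP; rewrite nv.
- rewrite (connect_inner_triangle _ t) inE nv /=; apply/negP=> H.
  by have := ni _ erefl; rewrite (triangle_inner _ t) H.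
have [_ _ Ix _] := diamond_inner d.
have cpv : connect inner p (val v) by rewrite (connect_inner_diamond _ d) !inE eqxx !orbT.
apply/negP=> cvo; have := connect_trans cpv cvo.
rewrite (connect_inner_diamond _ d) !inE nv.
have := ni _ erefl; rewrite Ix !inE => /norP[/negPf-> /negPf->] /= /eqP oy.
by case: d => _ _ + _; rewrite -oy ev.
Qed.

Lemma card_blob_class (v : exitT) (s : seq T) : uniq s ->
  (forall u, exit u -> connect inner (val v) u = (u \in s)) -> {in s, forall u, exit u} ->
  #|cls v| = size s.
Proof.
move=> U H X; rewrite -(card_imset _ val_inj) -(card_uniqP U); apply: eq_card => u.
apply/imsetP/idP => [[w]|us].
  by rewrite inE eq_sym blobE => vw ->; rewrite -H // (valP w).
by exists (Sub u (X u us)); rewrite ?SubK // inE eq_sym blobE SubK H ?X.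
Qed.

Lemma card_leaf (v : exitT) : degree e (val v) = 1 -> #|cls v| = 1.
Proof.
move=> d1; apply: (@card_blob_class v [:: val v]) => // [u _|u].
  by rewrite inE; apply/idP/eqP => [/(connect_inner_leaf d1)|->].
by rewrite inE => /eqP->; apply: valP.
Qed.

Lemma card_triangle (v : exitT) b c : triangle_blob (val v) b c -> #|cls v| = 3.
Proof.
move=> t; have [U _ _ _ [xv xb xc]] := t.
apply: (@card_blob_class v _ U) => [u _|u]; first exact: connect_inner_triangle.
by rewrite !inE => /or3P[]/eqP->.
Qed.

Lemma diamond_connect_end p q x y u : diamond_blob p q x y ->
  connect inner x u = (u \in [:: p; q; x; y]).
Proof.
move=> d; rewrite -(connect_inner_diamond _ d).
have px : connect inner p x by rewrite (connect_inner_diamond _ d) !inE eqxx !orbT.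
exact/esym/same_connect/px/inner_connect_sym.
Qed.

Lemma card_diamond (v : exitT) p q y : diamond_blob p q (val v) y -> #|cls v| = 2.
Proof.
move=> d; have [U _ _ [np nq xv xy]] := d.
apply: (@card_blob_class v [:: val v; y]) => [|u xu|u].
- by move: U => /and3P[].
- rewrite (diamond_connect_end _ d) !inE.
  have [up|_] := eqVneq u p; first by rewrite -up xu in np.
  by have [uq|_ //] := eqVneq u q; rewrite -uq xu in nq.
by rewrite !inE => /orP[]/eqP->.
Qed.

Lemma blob_class_le3 v : #|cls v| <= 3.
Proof.
by case: (exit_cases (valP v)) => [/card_leaf->|[b [c /card_triangle->]]|[p [q [y /card_diamond->]]]].
Qed.

Lemma deg3_class v : degree e (val v) = 3 -> 1 < #|cls v|.
Proof.
by move=> d3; case: (exit_cases (valP v)) => [|[b [c /card_triangle->]]|[p [q [y /card_diamond->]]]] //;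
  rewrite d3.
Qed.

(** Transfers connectedness from the graph to the exits: the vertices in the blobs of [S] are closed
    under inner edges, and under outer edges through [outer_nbr]. *)
Lemma blobs_connected (S : {set exitT}) : S != set0 ->
  (forall v, v \in S -> outer_nbr v \in S) ->
  (forall u v, v \in S -> blob u = blob v -> u \in S) -> S = setT.
Proof.
move=> /set0Pn[s sS] So Sb.
pose P u := [exists v, (v \in S) && connect inner (val v) u].
have inS v : P (val v) -> v \in S.
  case/existsP=> w /andP[wS wv]; apply: Sb wS _.
  by apply/eqP; rewrite eq_sym blobE.
have PT : forall y, P y.
  apply: (graph_closed (x := val s)) => [|u w Pu].
    by apply/existsP; exists s; rewrite sS connect0.
  rewrite outer_or_inner => /orP[uw|uw]; last first.
    case/existsP: Pu => v /andP[vS vu]; apply/existsP; exists v.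
    by rewrite vS (connect_trans vu (connect1 uw)).
  have xu : exit u by apply/existsP; exists w.
  have xw : exit w by apply/existsP; exists u; rewrite outer_sym.
  have uS : Sub u xu \in S by apply: inS; rewrite SubK.
  apply/existsP; exists (Sub w xw); rewrite SubK connect0 andbT.
  have <- : outer_nbr (Sub u xu) = Sub w xw by apply: outer_nbrP; rewrite !SubK.
  exact: So.
by apply/setP=> v; rewrite inE inS.
Qed.

Lemma outerE (v : exitT) u : outer (val v) u = (u == val (outer_nbr v)).
Proof.
apply/idP/eqP => [|->]; last exact: outer_outer_nbr.
exact: outer_uniq (outer_outer_nbr v).
Qed.

(** Colours are handled as functions of two vertices, symmetric on edges; the passage to functions
    on edges is postponed to the end. *)
Definition ncol (f : T -> T -> 'I_3) v := #|[set f v u | u in [set u | e v u]]|.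

Lemma ncol3 f v x y z : (forall u, e v u = (u \in [:: x; y; z])) ->
  ncol f v = size (undup [:: f v x; f v y; f v z]).
Proof.
move=> N; rewrite -(card_uniqP (undup_uniq _)) /ncol; apply: eq_card => c.
rewrite mem_undup; apply/imsetP/idP => [[u]|].
  by rewrite inE N !inE => /or3P[]/eqP-> ->; rewrite eqxx ?orbT.
rewrite !inE => /or3P[]/eqP->; [exists x|exists y|exists z] => //;
  by rewrite inE N !inE eqxx ?orbT.
Qed.

Lemma triangle_nbrs (v : exitT) b c : triangle_blob (val v) b c ->
  forall u, e (val v) u = (u \in [:: b; c; val (outer_nbr v)]).
Proof.
by move=> t u; rewrite outer_or_inner outerE (triangle_inner _ t) !inE orbC orbA.
Qed.

Lemma diamond_end_nbrs (v : exitT) p q y : diamond_blob p q (val v) y ->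
  forall u, e (val v) u = (u \in [:: p; q; val (outer_nbr v)]).
Proof.
move=> d u; have [_ _ Ix _] := diamond_inner d.
by rewrite outer_or_inner outerE Ix !inE orbC orbA.
Qed.

Lemma diamond_swap p q x y : diamond_blob p q x y -> diamond_blob p q y x.
Proof.
case=> U [pq px py qx qy] nxy [np nq ex ey]; split=> //; last by rewrite e_sym.
move: U; rewrite /= !inE !negb_or [y == x]eq_sym.
by case/and4P=> [/and3P[-> -> ->] /andP[-> ->] -> _].
Qed.

(** * Cycles of diamonds and their number of vertices *)

Lemma all_diamonds v : (forall v, #|cls v| = 2) -> exit v ->
  exists p q y, diamond_blob p q v y.
Proof.
move=> c2 xv; have [w wE] : exists w : exitT, val w = v by exists (Sub v xv); rewrite SubK.
subst v; case: (exit_cases xv) => [/card_leaf|[b [c /card_triangle]]|//]; by rewrite c2.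
Qed.

(** Double counting of the edges between ends and centres: each centre is adjacent to two ends and
    each end to two centres, so there are as many centres as ends. *)
Lemma card_all_diamonds : (forall v, #|cls v| = 2) -> #|T| = 2 * #|{: exitT}|.
Proof.
move=> c2; rewrite card_sig -(cardC exit) mul2n -addnn; congr (_ + _).
apply/eqP; rewrite -(eqn_pmul2r (isT : 0 < 2)) -!sum_nat_const; apply/eqP.
pose E v p := if e v p then 1 else 0.
transitivity (\sum_(p | ~~ exit p) \sum_(v | exit v) E p v).
  apply: eq_bigr => p np; have [q [x [y d]]] := center_diamond np.
  have [Np _] := diamond_nbrs d; have [U _ _ [_ nq xx xy]] := d.
  rewrite -big_mkcondr sum1dep_card (_ : [set _ | _] = [set x; y]).
    by move: U; rewrite cards2 /= !inE !negb_or => /and4P[_ _ -> _].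
  apply/setP=> u; rewrite !inE Np !inE; have [uq|_] := eqVneq u q.
    rewrite uq (negPf nq); move: U; rewrite /= !inE !negb_or.
    by case/and3P=> _ /andP[/negPf-> /negPf->].
  by case: eqP => [->|_]; rewrite ?xx //; case: eqP => [->|_]; rewrite ?xy // andbF.
rewrite exchange_big; apply: eq_bigr => v xv /=.
have [p [q [y d]]] := all_diamonds c2 xv; have [U [pq _ _ _ _] _ [np nq _ _]] := d.
have [_ _ Ix _] := diamond_inner d.
under eq_bigr => z _ do rewrite /E e_sym.
rewrite -big_mkcondr sum1dep_card (_ : [set _ | _] = [set p; q]).
  by rewrite cards2 e_neq.
apply/setP=> u; rewrite !inE outer_or_inner Ix !inE; have [ou|_] := boolP (outer v u).
  have -> : exit u by apply/existsP; exists v; rewrite outer_sym.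
  apply/esym/negbTE; rewrite negb_or; apply/andP; split.
    by apply: contraNneq np => <-; apply/existsP; exists v; rewrite outer_sym.
  by apply: contraNneq nq => <-; apply/existsP; exists v; rewrite outer_sym.
by case: eqP => [->|_]; rewrite ?np //; case: eqP => [->|_]; rewrite ?nq // andbF.
Qed.

Lemma diamond_blob_diamond p q x y : diamond_blob p q x y -> diamond e p q x y.
Proof.
case=> U [pq px py qx qy] _ _; move: U; rewrite /= !inE !negb_or !andbT.
case/and3P=> /and3P[npq npx npy] /andP[nqx nqy] nxy.
by split=> //; rewrite /ucycle /= !inE !negb_or npq ?npx ?npy ?nqx ?nqy pq ?qx ?qy e_sym ?px ?py.
Qed.

Lemma all_diamonds_cycle : (forall v, #|cls v| = 2) -> cycle_of_diamonds e.
Proof.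
move=> c2; split=> v; have [xv|nx] := boolP (exit v).
- have [p [q [y d]]] := all_diamonds c2 xv; have [_ [pq px _ qx _] _ _] := d.
  by apply: (two_nbrs_deg3 _ _ (e_neq pq)); rewrite e_sym.
- exact: nonexit_deg3.
- have [p [q [y d]]] := all_diamonds c2 xv; exists p, q, v, y.
  by split; [apply: diamond_blob_diamond|rewrite !inE eqxx !orbT].
have [q [x [y d]]] := center_diamond nx; exists v, q, x, y.
by split; [apply: diamond_blob_diamond|rewrite !inE eqxx].
Qed.

Lemma diamond_center_nonexit a b x y : diamond e a b x y -> ~~ exit a /\ ~~ exit b.
Proof.
rewrite /diamond /ucycle /= !inE !negb_or !andbT.
case=> /andP[/and3P[ab bx xa] _] /andP[/and3P[_ by_ ya] _] xy.
have ba : e b a by rewrite e_sym.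
have ax : e a x by rewrite e_sym.
have ay : e a y by rewrite e_sym.
have key c d : e c d -> e c x -> e c y -> e d x -> e d y -> ~~ exit c.
  move=> cd cx cy dx dy; have d3 := two_nbrs_deg3 cx cy xy.
  have N := deg3_nbrs d3 _ cd cx cy.
  apply/existsPn=> w; rewrite /outer N; last by rewrite /= !inE negb_or (e_neq dx) (e_neq dy) xy.
  rewrite !inE; apply/negP=> /andP[/or3P[]/eqP->]; case/negP.
  - exact: common_triangle cx dx.
  - by apply: (common_triangle cd); rewrite e_sym.
  by apply: (common_triangle cd); rewrite e_sym.
by split; [apply: key ab _ _ _ _|apply: key ba _ _ _ _].
Qed.

(** An exit is an end of its diamond and so is adjacent to a non-exit, whereas all neighbours of a
    vertex of a triangle blob are exits. *)
Lemma cycle_all_diamonds : cycle_of_diamonds e -> forall v, #|cls v| = 2.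
Proof.
move=> [d3 dia] v; have [a [b [x [y [D vD]]]]] := dia (val v).
have [na nb] := diamond_center_nonexit D.
have xa : e x a /\ e y a.
  by case: D; rewrite /ucycle /= !andbT => /andP[/and3P[_ _ ->] _] /andP[/and3P[_ _ ->] _].
have va : e (val v) a.
  move: vD; rewrite !inE => /or4P[]/eqP vE.
  - by rewrite -vE (valP v) in na.
  - by rewrite -vE (valP v) in nb.
  - by rewrite vE; case: xa.
  by rewrite vE; case: xa.
case: (exit_cases (valP v)) => [d1|[b' [c' t]]|[p [q [z d]]]].
- by rewrite d3 in d1.
- have [_ _ _ _ [_ xb xc]] := t; move: va na; rewrite (triangle_nbrs t) !inE.
  by case/or3P=> /eqP->; rewrite ?xb ?xc // (valP (outer_nbr v)).
exact: card_diamond d.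
Qed.

(** * From types to edge colours *)

Definition ncol_of_type (t : option bool) :=
  match t with None => 1 | Some false => 2 | Some true => 3 end.

Lemma color_other (i j k t : 'I_3) :
  i != k -> j != i -> j != k -> t != k -> (t == i) || (t == j).
Proof.
by case: i j k t => [[|[|[|i]]] ?] [[|[|[|j]]] ?] [[|[|[|k]]] ?] [[|[|[|t]]] ?].
Qed.

Variables (tau : exitT -> option bool) (k : exitT -> 'I_3).
Hypothesis tauP : valid_types outer_nbr blob tau.
Hypothesis k_o : forall v, k (outer_nbr v) = k v.
Hypothesis k_triangle : forall u v, #|cls v| = 3 -> blob u = blob v -> u != v ->
  tau v = Some true -> k u != k v.
Hypothesis k_diamond : forall u v, #|cls v| = 2 -> blob u = blob v ->
  tau v = Some true -> k u = k v.

Definition good_on (f : T -> T -> 'I_3) (C : pred T) :=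
  (forall v : exitT, C (val v) -> degree e (val v) = 3 ->
     ncol f (val v) = ncol_of_type (tau v)) /\
  (forall u w, C u -> inner u w -> ncol f u != ncol f w).

(** Reads [F] on inner edges at [C] only, so that solutions found blob by blob can be glued along
    the prescribed outer colours. *)
Definition fits (f F : T -> T -> 'I_3) (C : pred T) :=
  (forall u w, C u -> inner u w -> f u w = F u w) /\
  (forall v : exitT, f (val v) (val (outer_nbr v)) = k v).

Lemma triangle_sorted a b c : triangle_blob a b c ->
  exists m r d : exitT, [/\ triangle_blob (val m) (val r) (val d),
    [:: val m; val r; val d] =i [:: a; b; c],
    tau m = None, tau r = Some true & tau d = Some false].
Proof.
move=> t; have [U ab ac bc [xa xb xc]] := t.
have [va aE] : exists v : exitT, val v = a by exists (Sub a xa); rewrite SubK.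
have [vb bE] : exists v : exitT, val v = b by exists (Sub b xb); rewrite SubK.
have [vc cE] : exists v : exitT, val v = c by exists (Sub c xc); rewrite SubK.
subst a b c.
have [t1 t2] := triangle_perm t; have [t3 t4] := triangle_perm t1; have [t5 _] := triangle_perm t2.
have [_ tau3 _] := tauP.
have bl_a u : val u \in [:: val va; val vb; val vc] -> blob u = blob va.
  by move=> H; apply/eqP; rewrite eq_sym blobE (connect_inner_triangle _ t).
have bb : blob vb = blob va by apply: bl_a; rewrite !inE eqxx ?orbT.
have bc' : blob vc = blob va by apply: bl_a; rewrite !inE eqxx ?orbT.
move: U; rewrite /= !inE !negb_or !(inj_eq val_inj) andbT => /andP[/andP[nab nac] nbc].
have c3 := card_triangle t; have c3c : #|cls vc| = 3 by rewrite (cls_eq bc').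
have T1 := tau3 vb va c3 bb; have T2 := tau3 vc va c3 bc'.
have T3 := tau3 vb vc c3c (etrans bb (esym bc')) nbc.
rewrite eq_sym in T1; have {}T1 := T1 nab; rewrite [_ == va]eq_sym in T2; have {}T2 := T2 nac.
move: T1 T2 T3; case Ea: (tau va) => [[]|]; case Eb: (tau vb) => [[]|];
  case Ec: (tau vc) => [[]|] // _ _ _;
  [exists vc, va, vb|exists vb, va, vc|exists vc, vb, va|
   exists vb, vc, va|exists va, vb, vc|exists va, vc, vb]; split=> // u; rewrite !inE;
  by case: (u == val va); case: (u == val vb); case: (u == val vc).
Qed.

(** Both inner edges at [m] repeat [k m], and the edge between [r] and [d] gets the colour [j] other
    than [k m] and [k r]. Then [r] sees three colours, and [d] sees two because [k d], being
    different from [k r], is [k m] or [j]. *)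
Lemma local_triangle m r d : triangle_blob (val m) (val r) (val d) ->
  tau m = None -> tau r = Some true -> tau d = Some false ->
  exists2 F : T -> T -> 'I_3, forall u w, F u w = F w u &
  forall f, fits f F (mem [:: val m; val r; val d]) -> good_on f (mem [:: val m; val r; val d]).
Proof.
move=> t tm tr td; have [t1 t2] := triangle_perm t; have [t3 t4] := triangle_perm t1.
have [U _ _ _ _] := t.
have c3r : #|cls r| = 3 by apply: card_triangle t1.
have bl_r u : val u \in [:: val r; val d; val m] -> blob u = blob r.
  by move=> H; apply/eqP; rewrite eq_sym blobE (connect_inner_triangle _ t1).
have kmr : k m != k r.
  by apply: k_triangle; rewrite ?bl_r ?inE ?eqxx ?orbT //; apply: contra_eq_neq tm => ->; rewrite tr.
have kdr : k d != k r.
  by apply: k_triangle; rewrite ?bl_r ?inE ?eqxx ?orbT //; apply: contra_eq_neq td => ->; rewrite tr.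
have [jm jr] := avoidP (k m) (k r); set j := avoid (k m) (k r) in jm jr.
move: U; rewrite /= !inE !negb_or andbT => /andP[/andP[nmr nmd] nrd].
exists (fun u w => if (u == val m) || (w == val m) then k m else j).
  by move=> u w; rewrite orbC.
move=> f [fF fo].
have fm u : inner (val m) u -> f (val m) u = k m.
  by move=> mu; rewrite fF ?eqxx // !inE eqxx.
have frm : f (val r) (val m) = k m.
  by rewrite fF ?eqxx ?orbT // ?(triangle_inner _ t1) !inE eqxx ?orbT.
have frd : f (val r) (val d) = j.
  rewrite fF ?(triangle_inner _ t1) ?inE ?eqxx ?orbT //.
  by rewrite ![_ == val m]eq_sym (negPf nmr) (negPf nmd).
have fdm : f (val d) (val m) = k m.
  by rewrite fF ?eqxx ?orbT // ?(triangle_inner _ t3) !inE eqxx ?orbT.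
have fdr : f (val d) (val r) = j.
  rewrite fF ?(triangle_inner _ t3) ?inE ?eqxx ?orbT //.
  by rewrite ![_ == val m]eq_sym (negPf nmr) (negPf nmd).
have nm : ncol f (val m) = 1.
  rewrite (ncol3 _ (triangle_nbrs t)) fo !fm ?(triangle_inner _ t) ?inE ?eqxx ?orbT //=.
  by rewrite !inE eqxx.
have nr : ncol f (val r) = 3.
  rewrite (ncol3 _ (triangle_nbrs t1)) fo frm frd /= !inE (negPf jm) (negPf jr).
  by rewrite (negPf kmr).
have nd : ncol f (val d) = 2.
  rewrite (ncol3 _ (triangle_nbrs t3)) fo fdm fdr /= !inE [k m == j]eq_sym (negPf jm) /=.
  have /orP[/eqP->|/eqP->] := color_other kmr jm jr kdr; rewrite eqxx ?(negPf jm) //.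
  by rewrite [k m == j]eq_sym (negPf jm).
split=> [v|u w]; rewrite !inE.
  by case/or3P=> /eqP/val_inj-> _; rewrite (nm, nr, nd) (tm, tr, td).
case/or3P=> /eqP->; rewrite ((triangle_inner _ t), (triangle_inner _ t1), (triangle_inner _ t3)) !inE;
  by case/orP=> /eqP->; rewrite ?nm ?nr ?nd.
Qed.

(** All edges at the centre [p] get one colour. The ends have the same type, 2 or 3, and the centre
    [q] is given the other of these two numbers. *)
Lemma local_diamond p q (x y : exitT) : diamond_blob p q (val x) (val y) ->
  exists2 F : T -> T -> 'I_3, forall u w, F u w = F w u &
  forall f, fits f F (mem [:: p; q; val x; val y]) -> good_on f (mem [:: p; q; val x; val y]).
Proof.
move=> d; have d' := diamond_swap d; have [U [pq px py qx qy] nxy [np nq _ _]] := d.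
have [Ip Iq Ix Iy] := diamond_inner d; have [Np Nq] := diamond_nbrs d.
have c2x := card_diamond d; have c2y := card_diamond d'.
have byx : blob y = blob x.
  by apply/eqP; rewrite eq_sym blobE (diamond_connect_end _ d) !inE eqxx !orbT.
have [_ _ tau2] := tauP; have [tyx tx] := tau2 _ _ c2x byx.
move: U; rewrite /= !inE !negb_or andbT => /and3P[/and3P[npq npx npy] /andP[nqx nqy] nxy'].
have neq : ((q == p) = false) * ((val x == p) = false) * ((val y == p) = false)
    * ((q == val x) = false) * ((val y == val x) = false).
  rewrite -!(eq_sym p) (negPf npq) (negPf npx) (negPf npy) (negPf nqx).
  by rewrite eq_sym (negPf nxy').
have main (i jx jy : 'I_3) (n : nat) :
    (forall f, f p q = i -> f p (val x) = i -> f p (val y) = i ->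
       f q p = i -> f q (val x) = jx -> f q (val y) = jy ->
       f (val x) p = i -> f (val x) q = jx -> f (val x) (val (outer_nbr x)) = k x ->
       f (val y) p = i -> f (val y) q = jy -> f (val y) (val (outer_nbr y)) = k y ->
       [/\ ncol f p = 1, ncol f q = n, ncol f (val x) = ncol_of_type (tau x),
           ncol f (val y) = ncol_of_type (tau x) &
           uniq [:: 1; n; ncol_of_type (tau x)]]) ->
  exists2 F : T -> T -> 'I_3, forall u w, F u w = F w u &
  forall f, fits f F (mem [:: p; q; val x; val y]) -> good_on f (mem [:: p; q; val x; val y]).
  move=> H; exists (fun u w => if (u == p) || (w == p) then i else
      if (u == val x) || (w == val x) then jx else jy).
    by move=> u w; rewrite ![(u == _) || _]orbC.
  move=> f [fF fo].
  have [||||||||||||n1 nn n3 n4 Un] := H f;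
    rewrite ?fo ?fF ?Ip ?Iq ?Ix ?Iy ?inE ?eqxx ?orbT //;
    rewrite ?neq //.
  rewrite /= !inE negb_or andbT in Un; case/andP: Un => /andP[n12 n13] n23.
  split=> [v|u w]; rewrite !inE.
    have noexit r : ~~ exit r -> (val v == r) = false.
      by move=> nr; apply: contraNF nr => /eqP<-; apply: valP.
    rewrite (noexit p) // (noexit q) //= => /orP[]/eqP/val_inj-> _ //.
    by rewrite n4 tyx.
  case/or4P=> /eqP->; rewrite ?Ip ?Iq ?Ix ?Iy !inE.
  - by case/or3P=> /eqP->; rewrite n1 ?nn ?n3 ?n4.
  - by case/or3P=> /eqP->; rewrite nn ?n1 ?n3 ?n4 // eq_sym.
  - by rewrite n3; case/orP=> /eqP->; rewrite ?n1 ?nn eq_sym.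
  by rewrite n4; case/orP=> /eqP->; rewrite ?n1 ?nn eq_sym.
have Nx := diamond_end_nbrs d; have Ny := diamond_end_nbrs d'.
have three (a b c : 'I_3) : a != b -> b != c -> a != c -> size (undup [:: a; b; c]) = 3.
  by move=> ab bc ac; rewrite /= !inE (negPf ab) (negPf ac) (negPf bc).
have two (a b c : 'I_3) : a != b -> (c == a) || (c == b) -> size (undup [:: a; b; c]) = 2.
  move=> ab; rewrite /= !inE [b == c]eq_sym [a == c]eq_sym (negPf ab) /=.
  by case/orP=> /eqP->; rewrite eqxx ?(negPf ab) //= eq_sym (negPf ab).
(* Ends of type 3 share their outer colour, and the two other colours [i] and [j] serve for the
   edges at [p] and for those from [q] to the ends. *)
case tauE: (tau x) tx => [[]|] // _.
  have kyx : k y = k x by apply: k_diamond.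
  have [ix _] := avoidP (k x) (k x); set i := avoid (k x) (k x) in ix.
  have [jx ji] := avoidP (k x) i; set j := avoid (k x) i in jx ji; rewrite eq_sym in ji.
  apply: (main i j j 2) => f pq1 px1 py1 qp1 qx1 qy1 xp1 xq1 xo1 yp1 yq1 yo1; rewrite tauE.
  rewrite (ncol3 _ Np) (ncol3 _ Nq) (ncol3 _ Nx) (ncol3 _ Ny) pq1 px1 py1 qp1 qx1 qy1 xp1 xq1 xo1 yp1 yq1 yo1 kyx.
  split=> //; [by rewrite /= !inE eqxx|by apply: two; rewrite ?eqxx ?orbT|exact: three|exact: three].
(* Ends of type 2: [p] uses [k x], so [x] sees [k x] and [jx] only. The choice of [jy] makes [k y]
   one of [k x] and [jy], so [y] sees two colours, while [q] sees all three. *)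
pose jy := if k y == k x then avoid (k x) (k x) else k y.
have jyx : k x != jy.
  rewrite /jy eq_sym; case: ifP => [_|/negbT//]; by case: (avoidP (k x) (k x)).
have [jx1 jx2] := avoidP (k x) jy; set jx := avoid (k x) jy in jx1 jx2.
have kyc : (k y == k x) || (k y == jy) by rewrite /jy; case: (k y == k x); rewrite ?eqxx ?orbT.
apply: (main (k x) jx jy 3) => f pq1 px1 py1 qp1 qx1 qy1 xp1 xq1 xo1 yp1 yq1 yo1; rewrite tauE.
rewrite (ncol3 _ Np) (ncol3 _ Nq) (ncol3 _ Nx) (ncol3 _ Ny) pq1 px1 py1 qp1 qx1 qy1 xp1 xq1 xo1 yp1 yq1 yo1.
rewrite eq_sym in jx1.
by split=> //; [rewrite /= !inE eqxx|apply: three|apply: two; rewrite ?eqxx|apply: two].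
Qed.

Lemma local_colors r :
  exists2 F : T -> T -> 'I_3, forall u w, F u w = F w u &
  forall f, fits f F (connect inner r) -> good_on f (connect inner r).
Proof.
have wlog_seq (s : seq T) : connect inner r =i s ->
    (exists2 F : T -> T -> 'I_3, forall u w, F u w = F w u &
      forall f, fits f F (mem s) -> good_on f (mem s)) ->
    exists2 F : T -> T -> 'I_3, forall u w, F u w = F w u &
      forall f, fits f F (connect inner r) -> good_on f (connect inner r).
  move=> E [F Fs FP]; have E' u : connect inner r u = (u \in s) by apply: E.
  exists F => // f [f1 f2]; have [|g1 g2] := FP f.
    by split=> // u w; rewrite /= -E'; apply: f1.
  by split=> [v|u w]; rewrite E'; [apply: g1|apply: g2].
have dia p q x y : diamond_blob p q x y -> connect inner r =i [:: p; q; x; y] ->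
    exists2 F : T -> T -> 'I_3, forall u w, F u w = F w u &
      forall f, fits f F (connect inner r) -> good_on f (connect inner r).
  move=> d /wlog_seq; apply; have [_ _ _ [_ _ xx xy]] := d.
  by have := @local_diamond p q (Sub x xx) (Sub y xy); rewrite !SubK; apply.
have [xr|nr] := boolP (exit r); last first.
  have [q [x [y d]]] := center_diamond nr; apply: (dia _ _ _ _ d) => u.
  exact: connect_inner_diamond d.
case: (exit_cases xr) => [d1|[b [c t]]|[p [q [y d]]]].
- exists (fun _ _ => ord0) => // f _; split=> [v /(connect_inner_leaf d1) ->|u w].
    by rewrite d1.
  by move/(connect_inner_leaf d1)->; rewrite leaf_inner.
- have [m [r' [d [t' E tm tr td]]]] := triangle_sorted t.
  apply: wlog_seq (local_triangle t' tm tr td) => u.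
  by rewrite E -(connect_inner_triangle _ t).
by apply: (dia _ _ _ _ d) => u; apply: diamond_connect_end d.
Qed.

(** The local solution is chosen by the root of the blob, hence is the same for both ends of an
    inner edge. Across outer edges the counts differ because the types do. *)
Lemma exists_edge_colors : exists f : T -> T -> 'I_3,
  [/\ forall u w, e u w -> f u w = f w u,
      forall v : exitT, degree e (val v) = 3 -> ncol f (val v) = ncol_of_type (tau v) &
      forall u w, e u w -> degree e u = 3 -> degree e w = 3 -> ncol f u != ncol f w].
Proof.
have /fin_all_exists2[F Fs FP] := local_colors.
pose kT u := if insub u is Some v then k v else ord0.
have kTE v : kT (val v) = k v by rewrite /kT valK.
pose f u w := if outer u w then kT u else F (root inner u) u w.
have rootE u w : connect inner u w -> root inner u = root inner w.
  exact/rootP/inner_connect_sym.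
have fs u w : e u w -> f u w = f w u.
  rewrite outer_or_inner /f outer_sym; have [wu _|_ /= uw] := boolP (outer w u).
    have xu : exit u by apply/existsP; exists w; rewrite outer_sym.
    have xw : exit w by apply/existsP; exists u.
    have [vu uE] : exists v : exitT, val v = u by exists (Sub u xu); rewrite SubK.
    have [vw wE] : exists v : exitT, val v = w by exists (Sub w xw); rewrite SubK.
    have E : outer_nbr vw = vu by apply: outer_nbrP; rewrite wE uE.
    by rewrite -uE -wE !kTE -E k_o.
  by rewrite (rootE _ _ (connect1 uw)) Fs.
have good r : good_on f (connect inner (root inner r)).
  apply: FP; split=> [u w ru /andP[_ cuw]|v]; last by rewrite /f outer_outer_nbr kTE.
  rewrite /f /outer cuw andbF -(rootE _ _ ru) root_root //; exact: inner_connect_sym.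
have croot u : connect inner (root inner u) u by rewrite inner_connect_sym connect_root.
have fv (v : exitT) : degree e (val v) = 3 -> ncol f (val v) = ncol_of_type (tau v).
  by case: (good (val v)) => g _; apply: g.
exists f; split=> // u w; rewrite outer_or_inner => /orP[uw|uw] d3u d3w; last first.
  by case: (good u) => _ g; apply: g.
have xu : exit u by apply/existsP; exists w.
have xw : exit w by apply/existsP; exists u; rewrite outer_sym.
have [vu uE] : exists v : exitT, val v = u by exists (Sub u xu); rewrite SubK.
have [vw wE] : exists v : exitT, val v = w by exists (Sub w xw); rewrite SubK.
subst u w; rewrite !fv //; have E := outer_nbrP uw; have [tauo _ _] := tauP.
have := tauo vu; rewrite E => /(_ (deg3_class d3u) (deg3_class d3w)).
by case: (tau vu) (tau vw) => [[]|] [[]|].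
Qed.

End Blobs.

(** * From edge colours to [cstar] *)

Section ColorCounts.

Variables (T : finType) (e : rel T).
Hypothesis simple_e : simple_graph e.
Implicit Type c : coloring e.

Definition edge_color (c : coloring e) u w : 'I_3 :=
  if insub [set u; w] is Some A then c A else ord0.

Lemma edge_colorC c u w : edge_color c u w = edge_color c w u.
Proof. by rewrite /edge_color setUC. Qed.

Lemma mem_edge_set u w : e u w -> [set u; w] \in edge_set e.
Proof. by move=> uw; rewrite inE; apply/existsP; exists u; apply/existsP; exists w; rewrite uw eqxx. Qed.

Lemma edge_setP (A : {set T}) v : A \in edge_set e -> v \in A ->
  exists2 u, e v u & A = [set v; u].
Proof.
rewrite inE => /existsP[x /existsP[y /andP[xy /eqP->]]]; rewrite !inE => /orP[]/eqP->.
  by exists y.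
by exists x; rewrite 1?e_sym // setUC.
Qed.

Lemma set2_injr (v : T) u w : u != v -> [set v; u] = [set v; w] -> u = w.
Proof.
move=> uv E; have : u \in [set v; w] by rewrite -E !inE eqxx orbT.
by rewrite !inE (negPf uv) => /eqP.
Qed.

Lemma color_countE c v i :
  color_count c v i = #|[set u | e v u && (edge_color c v u == i)]|.
Proof.
rewrite /color_count -(card_imset _ val_inj).
rewrite -[RHS](@card_in_imset _ _ (fun u => [set v; u])); last first.
  by move=> u w; rewrite !inE => /andP[vu _] _; apply: set2_injr; rewrite eq_sym (e_neq simple_e vu).
apply: eq_card => A; apply/imsetP/imsetP => [[B]|[u]].
  rewrite inE => /andP[vB /eqP cB] ->; have [u vu BE] := edge_setP (valP B) vB.
  by exists u => //; rewrite inE vu /edge_color -BE valK cB eqxx.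
rewrite inE => /andP[vu /eqP cu] ->.
have [B BE] : exists B : edge e, val B = [set v; u].
  by exists (Sub [set v; u] (mem_edge_set vu)); rewrite SubK.
by exists B; rewrite // inE BE !inE eqxx -cu /edge_color -BE valK eqxx.
Qed.

(** A partition of 3 is determined by its number of parts, so the number of colours carries all of
    [cstar] at a vertex of degree 3. *)
Definition star_of_ncol n : seq nat :=
  match n with 1 => [:: 3; 0; 0] | 2 => [:: 2; 1; 0] | _ => [:: 1; 1; 1] end.

Lemma cstarE c v : cstar c v = sort geq [seq color_count c v i | i <- [:: ord0; inord 1; inord 2]].
Proof.
rewrite /cstar /cbar /= (_ : enum 'I_3 = [:: ord0; inord 1; inord 2]) //.
apply: (inj_map val_inj); rewrite val_enum_ord /= !inordK //.
Qed.

Lemma star_of_three (a b c : 'I_3) :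
  sort geq [seq count (pred1 i) [:: a; b; c] | i <- [:: ord0; inord 1; inord 2]] =
    star_of_ncol (size (undup [:: a; b; c])) /\
  0 < size (undup [:: a; b; c]) <= 3.
Proof.
have E (x y : 'I_3) : (x == y) = (val x == val y) by [].
rewrite /= !E /= !inordK // !inE !E.
by case: a b c => [[|[|[|a]]] ?] [[|[|[|b]]] ?] [[|[|[|c]]] ?].
Qed.

Lemma cstar_deg3 c v : degree e v = 3 ->
  cstar c v = star_of_ncol (ncol e (edge_color c) v) /\ 0 < ncol e (edge_color c) v <= 3.
Proof.
move=> d3; have d3' : size (enum [set u | e v u]) = 3 by rewrite -cardE.
have U := enum_uniq [set u | e v u].
have N u : e v u = (u \in enum [set u | e v u]) by rewrite mem_enum inE.
case: (enum _) d3' U N => [|x [|y [|z [|]]]] // _ U N.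
rewrite (ncol3 _ N) cstarE.
have E : color_count c v =1
    fun i => count (pred1 i) [:: edge_color c v x; edge_color c v y; edge_color c v z].
  move=> i; rewrite color_countE -[RHS]/(count (fun u => edge_color c v u == i) [:: x; y; z]).
  rewrite -size_filter -(card_uniqP (filter_uniq _ U)); apply: eq_card => u.
  by rewrite inE mem_filter N andbC.
rewrite (eq_map E); exact: star_of_three.
Qed.

Lemma cstar_deg1 c v : degree e v = 1 -> cstar c v = [:: 1; 0; 0].
Proof.
move=> /deg1_nbr[w N]; rewrite cstarE.
have E : color_count c v =1 fun i => edge_color c v w == i.
  move=> i; rewrite color_countE; case: eqP => [<-|ci].
    rewrite (_ : [set _ | _] = [set w]) ?cards1 //; apply/setP=> u.
    by rewrite !inE N; have [->|//] := eqVneq u w; rewrite eqxx.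
  apply/eqP; rewrite cards_eq0; apply/eqP/setP=> u; rewrite !inE N.
  by have [->|//] := eqVneq u w; apply/negbTE/eqP.
rewrite (eq_map E) /=; have val_eq (x y : 'I_3) : (x == y) = (val x == val y) by [].
by rewrite !val_eq /= !inordK //; case: (edge_color c v w) => [[|[|[|i]]] ?].
Qed.

Lemma star_of_ncol_inj m n : 0 < m <= 3 -> 0 < n <= 3 ->
  star_of_ncol m = star_of_ncol n -> m = n.
Proof. by case: m n => [|[|[|[|m]]]] [|[|[|[|n]]]]. Qed.

Lemma star_of_ncol_neq_leaf n : star_of_ncol n != [:: 1; 0; 0].
Proof. by case: n => [|[|[]]]. Qed.

(** Edges at leaves impose nothing: the other end has degree 3, and the colour counts sum to 1 at a
    leaf but to 3 there. *)
Lemma distinguishing_ncol c : (forall v, degree e v = 1 \/ degree e v = 3) ->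
  (forall v, degree e v = 1 -> exists w, e v w /\ degree e w = 3) ->
  color_blind_distinguishing c <->
  (forall u w, e u w -> degree e u = 3 -> degree e w = 3 ->
     ncol e (edge_color c) u != ncol e (edge_color c) w).
Proof.
move=> d13 leaf; split=> [H u w uw d3u d3w|H u w uw].
  by apply/eqP=> E; apply: (H u w uw); have [-> _] := cstar_deg3 c d3u; have [-> _] := cstar_deg3 c d3w; rewrite E.
have [d1u|d3u] := d13 u; have [d1w|d3w] := d13 w.
- have [z [uz d3z]] := leaf u d1u; have [x N] := deg1_nbr d1u.
  by move: uw uz d3z; rewrite !N => /eqP<- /eqP->; rewrite d1w.
- rewrite (cstar_deg1 c d1u); have [-> _] := cstar_deg3 c d3w.
  by apply/eqP; rewrite eq_sym star_of_ncol_neq_leaf.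
- rewrite (cstar_deg1 c d1w); have [-> _] := cstar_deg3 c d3u.
  by apply/eqP; rewrite star_of_ncol_neq_leaf.
have [-> bu] := cstar_deg3 c d3u; have [-> bw] := cstar_deg3 c d3w.
by move/(star_of_ncol_inj bu bw)/eqP; apply/negP/H.
Qed.

Lemma coloring_of_edge_colors (f : T -> T -> 'I_3) :
  (forall u w, e u w -> f u w = f w u) ->
  exists c : coloring e, forall u w, e u w -> edge_color c u w = f u w.
Proof.
move=> fs.
have H (A : edge e) : exists i : 'I_3, forall u w, e u w -> val A = [set u; w] -> f u w = i.
  have := valP A; rewrite inE => /existsP[x /existsP[y /andP[xy /eqP AE]]].
  exists (f x y) => u w uw; rewrite AE => E.
  have : x \in [set u; w] by rewrite -E !inE eqxx.
  rewrite !inE => /orP[]/eqP xE; subst x.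
    by rewrite (set2_injr _ E) // eq_sym (e_neq simple_e xy).
  rewrite fs //; congr f; rewrite [RHS](@set2_injr w _ u) //.
    by rewrite eq_sym (e_neq simple_e xy).
  by rewrite E setUC.
have [c cP] := fin_all_exists H; exists c => u w uw.
have [B BE] : exists B : edge e, val B = [set u; w].
  by exists (Sub [set u; w] (mem_edge_set uw)); rewrite SubK.
by rewrite /edge_color -BE valK -(cP B u w uw).
Qed.

Lemma eq_ncol (f g : T -> T -> 'I_3) v : (forall u, e v u -> f v u = g v u) ->
  ncol e f v = ncol e g v.
Proof.
move=> E; congr #|pred_of_set _|; apply: eq_in_imset => u; rewrite inE; exact: E.
Qed.

End ColorCounts.

(** * Distinguishing colorings and odd cycles of diamonds *)

Section Main.

Variables (T : finType) (e : rel T).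
Hypothesis simple_e : simple_graph e.
Hypothesis connected_e : connected_graph e.
Hypothesis degree_1_or_3 : forall v : T, degree e v = 1 \/ degree e v = 3.
Hypothesis leaf_nbr : forall v : T, degree e v = 1 -> exists w : T, e v w /\ degree e w = 3.
Hypothesis three_cycle_deg3 : forall v : T, degree e v = 3 -> in_three_cycle e v.

Let exit_exists_dec : (exists v, exit e v) \/ (forall v, ~~ exit e v).
Proof.
by have [/existsP[v xv]|/existsPn] := boolP [exists v, exit e v]; [left; exists v|right].
Qed.

(** A diamond blob has exits at its ends, so only the alternative K4 remains. *)
Lemma no_exit_K4 : (forall v, ~~ exit e v) ->
  exists p q x y : T, [/\ uniq [:: p; q; x; y],
    forall u w, u \in [:: p; q; x; y] -> w \in [:: p; q; x; y] -> u != w -> e u w &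
    forall u, u \in [:: p; q; x; y]].
Proof.
move=> nx; have [/card_gt0P[p _] _] := connected_e.
have [[q [x [y [_ _ _ [_ _ xx _]]]]]|[q [x [y [U [pq px py qx qy] xy A]]]]] :=
  center_diamond_or_K4 simple_e connected_e degree_1_or_3 three_cycle_deg3 (nx p).
  by rewrite (negPf (nx x)) in xx.
exists p, q, x, y; split=> // u w.
rewrite !inE => /or4P[]/eqP-> /or4P[]/eqP->; rewrite ?eqxx // => _;
  by [|rewrite e_sym].
Qed.

Lemma no_exit_odd_cycle : (forall v, ~~ exit e v) -> odd_cycle_of_diamonds e.
Proof.
move=> nx; have [p [q [x [y [U K A]]]]] := no_exit_K4 nx.
split; last first.
  exists 1; split=> //; rewrite muln1 -[4]/(size [:: p; q; x; y]) -(card_uniqP U).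
  by apply: eq_card => u; rewrite A.
split=> v; first exact: nonexit_deg3 (nx v).
exists p, q, x, y; split=> //.
have Kp z : z \in [:: x; y] -> ucycle e [:: p; q; z].
  move=> zxy.
  have [npq npz nqz] : [/\ p != q, z != p & q != z].
    move: U zxy; rewrite /= !inE !negb_or ![z == p]eq_sym.
    by case/and4P=> /and3P[-> px py] /andP[qx qy] _ _ /orP[]/eqP->.
  rewrite /ucycle /= !inE negb_or npq nqz [p == z]eq_sym npz !andbT.
  by rewrite !K ?A.
split; [by apply: Kp; rewrite !inE eqxx|by apply: Kp; rewrite !inE eqxx orbT|].
by move: U; rewrite /= !inE => /and4P[].
Qed.

Lemma coloring_of_types (exit_exists : exists v, exit e v) tau :
  valid_types (@outer_nbr T e) (@blob T e) tau ->
  exists2 c : coloring e, color_blind_distinguishing c &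
  forall v : exitT e, degree e (val v) = 3 ->
    cstar c (val v) = star_of_ncol (ncol_of_type (tau v)).
Proof.
move=> tauP.
have [k [k_o k3 k2]] := exists_outer_colors
  (outer_nbrK simple_e degree_1_or_3 three_cycle_deg3)
  (blob_outer_nbr simple_e connected_e degree_1_or_3 three_cycle_deg3 exit_exists) tauP.
have [f [fs fv fd]] := exists_edge_colors simple_e connected_e degree_1_or_3
  three_cycle_deg3 exit_exists tauP k_o k3 k2.
have [c cE] := coloring_of_edge_colors simple_e fs.
have nE v : ncol e (edge_color c) v = ncol e f v by apply: eq_ncol => u; apply: cE.
exists c => [|v d3].
  by apply/distinguishing_ncol => // u w uw d3u d3w; rewrite !nE; apply: fd.
by have [-> _] := cstar_deg3 simple_e c d3; rewrite nE fv.
Qed.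

Lemma coloring_of_not_odd_cycle :
  ~ odd_cycle_of_diamonds e -> exists c : coloring e, color_blind_distinguishing c.
Proof.
move=> nodd; have [ex|/no_exit_odd_cycle//] := exit_exists_dec.
have bo := blob_outer_nbr simple_e connected_e degree_1_or_3 three_cycle_deg3 ex.
have oK := outer_nbrK simple_e degree_1_or_3 three_cycle_deg3.
have [|tau tauP] := exists_valid_types oK bo
    (blob_class_le3 simple_e connected_e degree_1_or_3 three_cycle_deg3 ex)
    (@blobs_connected _ _ simple_e connected_e degree_1_or_3 three_cycle_deg3).
  move=> c2; apply/negP=> od; apply: nodd; split.
    exact: all_diamonds_cycle c2.
  (* The number of diamonds, as each has two exits. *)
  exists (#|{: exitT e}|./2); split=> //.
  rewrite (card_all_diamonds simple_e connected_e degree_1_or_3 three_cycle_deg3 ex c2).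
  have ev := even_card_exits oK bo.
  by rewrite -[in LHS](even_halfK ev) -mul2n mulnA.
by have [c cP _] := coloring_of_types ex tauP; exists c.
Qed.

Lemma two_stars_at_leaf v : degree e v = 3 -> (exists w : T, e v w /\ degree e w = 1) ->
  exists c1 c2 : coloring e, [/\ color_blind_distinguishing c1,
    color_blind_distinguishing c2 & cstar c1 v <> cstar c2 v].
Proof.
move=> d3 [w [vw d1]].
have wv : outer e w v by apply: leaf_exit; rewrite // e_sym.
have xw : exit e w by apply/existsP; exists v.
have xv : exit e v by apply/existsP; exists w; rewrite outer_sym.
have ex : exists v, exit e v by exists v.
have [a aE] : exists a : exitT e, val a = v by exists (Sub v xv); rewrite SubK.
have [b bE] : exists b : exitT e, val b = w by exists (Sub w xw); rewrite SubK.
have oab : outer_nbr a = b.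
  by apply: outer_nbrP; rewrite // aE bE outer_sym.
have leafb : #|cls (@blob T e) (outer_nbr a)| = 1.
  by rewrite oab; apply: card_leaf; rewrite // bE.
have S := valid_types_at_leaf (outer_nbrK simple_e degree_1_or_3 three_cycle_deg3)
    (blob_outer_nbr simple_e connected_e degree_1_or_3 three_cycle_deg3 ex)
    (blob_class_le3 simple_e connected_e degree_1_or_3 three_cycle_deg3 ex)
    (@blobs_connected _ _ simple_e connected_e degree_1_or_3 three_cycle_deg3) _ leafb.
(* The second use pins the leaf to the type that the first one gave to [a], which excludes that
   type. *)
have [t1 t1P _] := S None; have [t2 t2P t12] := S (t1 a).
have [c1 c1P c1E] := coloring_of_types ex t1P; have [c2 c2P c2E] := coloring_of_types ex t2P.
exists c1, c2; split=> //; rewrite -aE c1E ?aE // -aE c2E ?aE //.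
by case: (t1 a) (t2 a) t12 => [[]|] [[]|].
Qed.

(** On K4 four vertices would need distinct numbers among 1, 2 and 3. Otherwise the numbers of
    colours are valid types, and these force an even number of diamonds. *)
Lemma distinguishing_not_odd_cycle (c : coloring e) :
  color_blind_distinguishing c -> ~ odd_cycle_of_diamonds e.
Proof.
move=> /(distinguishing_ncol simple_e c degree_1_or_3 leaf_nbr); set n := ncol _ _ => nP.
case=> -[d3 dia] [t [odt cT]].
have {}nP u w : e u w -> n u != n w by move=> uw; apply: nP.
have n13 v : 0 < n v <= 3 by case: (cstar_deg3 simple_e c (d3 v)).
have [ex|/no_exit_K4[p [q [x [y [U K _]]]]]] := exit_exists_dec; last first.
  have : uniq [seq n z | z <- [:: p; q; x; y]].
    rewrite map_inj_in_uniq // => u w us ws E; apply/eqP; apply: contraT => uw.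
    by have := nP u w (K u w us ws uw); rewrite E eqxx.
  move=> Un; suff /(uniq_leq_size Un) : {subset [seq n z | z <- [:: p; q; x; y]] <= [:: 1; 2; 3]} by [].
  move=> _ /mapP[z _ ->]; have := n13 z.
  by case: (n z) => [|[|[|[|]]]].
have c2 := cycle_all_diamonds simple_e connected_e degree_1_or_3 three_cycle_deg3 ex (conj d3 dia).
pose tau (v : exitT e) :=
  match n (val v) with 1 => None | 3 => Some true | _ => Some false end.
suff tauP : valid_types (@outer_nbr T e) (@blob T e) tau.
  have := valid_types_even_diamonds (outer_nbrK simple_e degree_1_or_3 three_cycle_deg3) c2 tauP.
  have := card_all_diamonds simple_e connected_e degree_1_or_3 three_cycle_deg3 ex c2.
  rewrite cT -[4]/(2 * 2) -mulnA => /eqP; rewrite eqn_pmul2l // => /eqP <-.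
  by rewrite mul2n doubleK odt.
split=> [v _ _|u v|u v _ blu].
- have /andP[/nP + _] := outer_outer_nbr simple_e v.
  rewrite /tau; have := n13 (val v); have := n13 (val (outer_nbr v)).
  by case: (n (val v)) (n _) => [|[|[|[|a]]]] [|[|[|[|b]]]].
- by rewrite c2.
have [p [q [y d]]] := all_diamonds simple_e connected_e degree_1_or_3 three_cycle_deg3 ex c2 (valP v).
have [U [pq px py qx qy] _ [np nq _ xy]] := d; have [Np Nq] := diamond_nbrs simple_e degree_1_or_3 d.
have [w wE] : exists w : exitT e, val w = y by exists (Sub y xy); rewrite SubK.
subst y; have d' := diamond_swap simple_e d.
have one (a b a' : 'I_3) : size (undup [:: a; b; a']) = 1 -> a = b.
  rewrite /= !inE; have [->|_] := eqVneq b a'; last by case: ifP.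
  by rewrite orbb; case: eqP.
have f_eq (z : exitT e) y : diamond_blob e p q (val z) y -> n (val z) = 1 ->
    edge_color c p (val z) = edge_color c q (val z).
  move=> dz; rewrite /n (ncol3 _ (diamond_end_nbrs simple_e degree_1_or_3 three_cycle_deg3 dz)).
  by rewrite ![edge_color c _ (val z)]edge_colorC => /one.
(* The adjacent centres use two of the three values, and both ends must take the remaining one. *)
have nvw : n (val v) = n (val w).
  have := nP _ _ pq; have := nP _ _ px; have := nP _ _ py; have := nP _ _ qx; have := nP _ _ qy.
  have := n13 p; have := n13 q; have := n13 (val v); have := n13 (val w).
  by case: (n p) (n q) (n (val v)) (n (val w)) => [|[|[|[|a]]]] [|[|[|[|b]]]] [|[|[|[|a']]]] [|[|[|[|b']]]].
(* If each end saw a single colour, its edges to [p] and [q] would agree, and the two centres would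
   see the same colours. *)
have nv1 : n (val v) != 1.
  apply/eqP=> nv1; have := nP _ _ pq.
  rewrite /n (ncol3 _ Np) (ncol3 _ Nq) (f_eq _ _ d nv1) (f_eq _ _ d' (etrans (esym nvw) nv1)).
  by rewrite edge_colorC eqxx.
split; last by rewrite /tau; case: (n (val v)) nv1 => [|[|[|[|]]]].
have : connect (inner e) (val v) (val u) by rewrite -(blobE simple_e) blu.
rewrite (diamond_connect_end _ _ _ _ d) // !inE.
have noexit r : ~~ exit e r -> (val u == r) = false.
  by move=> nr; apply: contraNF nr => /eqP<-; apply: valP.
rewrite (noexit p) // (noexit q) // !orFb => /orP[]/eqP uE; first by rewrite /tau uE.
by rewrite /tau uE nvw.
Qed.

End Main.

Theorem theorem9 (T : finType) (e : rel T)
    (simple_e : simple_graph e)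
    (connected_e : connected_graph e)
    (degree_1_or_3 : forall v : T, degree e v = 1 \/ degree e v = 3)
    (leaf_nbr : forall v : T, degree e v = 1 ->
       exists w : T, e v w /\ degree e w = 3)
    (three_cycle_deg3 : forall v : T, degree e v = 3 -> in_three_cycle e v) :
  ((exists c : coloring e, color_blind_distinguishing c) <->
     ~ odd_cycle_of_diamonds e) /\
  ((exists c : coloring e, color_blind_distinguishing c) ->
     forall v : T, degree e v = 3 ->
       (exists w : T, e v w /\ degree e w = 1) ->
       exists c1 c2 : coloring e,
         [/\ color_blind_distinguishing c1,
             color_blind_distinguishing c2 &
             cstar c1 v <> cstar c2 v]).
Proof.
split; first split.
- by case=> c; apply: distinguishing_not_odd_cycle.
- exact: coloring_of_not_odd_cycle.
by move=> _ v; apply: two_stars_at_leaf.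
Qed.
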